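(* Let $(x,t)\in\mathbb{R}^d\times\mathbb{R}^+$ be such that $D_4(x,t)\subset\mathbb{R}^d\times\mathbb{R}^+$. There exist constants $\gamma>0$ and $c>0$ such that for every bounded function $f$ on $\mathbb{R}^d\times\mathbb{R}^+$ that is harmonic on $D_4(x,t)$, $$|f(y,s)-f(y',s')|\le c\,\|f\|_\infty\,|(y,s)-(y',s')|^\gamma\qquad\text{for all }(y,s),(y',s')\in D_1(x,t).$$ In particular $f$ is H\''older continuous in $D_1(x,t)$.
   Context: Let $d\ge1$, $0<\alpha<2$ and $\mathbb{R}^+=[0,\infty)$. $Y_t$ is a right-continuous symmetric $\alpha$-stable process in $\mathbb{R}^d$ (independent stationary increments, characteristic function $\mathbb{E}^0 e^{i\xi\cdot Y_t}=e^{-t|\xi|^\alpha}$). $Z_t$ is a one-dimensional Brownian motion independent of $Y_t$, normalized so that its first hitting time of $0$ started from $t>0$ has law $\frac{t}{2\sqrt\pi}e^{-t^2/4s}s^{-3/2}\,ds$ (i.e. $\mathrm{Var}(Z_s)=2s$). $X_t=(Y_t,Z_t)$ is the product process, and $\mathbb{P}^{(x,t)}$, $\mathbb{E}^{(x,t)}$ denote probability and expectation for $X$ started at $(x,t)$. Boxes: for $x\in\mathbb{R}^d$, $t\in\mathbb{R}$, $r>0$, $D_r(x,t)=\{(y,s)\in\mathbb{R}^d\times\mathbb{R}:\ |x_i-y_i|<r^{2/\alpha}/2\ (i=1,\dots,d),\ |s-t|<r/2\}$. For a Borel set $A\subset\mathbb{R}^{d+1}$, $\tau_A=\inf\{v\ge0:X_v\notin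 A\}$ is the first exit time from $A$. A Borel function $u$ on $\mathbb{R}^d\times\mathbb{R}^+$ is called harmonic in (on) an open box $D$ contained in $\mathbb{R}^d\times\mathbb{R}^+$ if $u$ is continuous on $D$ and $u(X_{v\wedge\tau_D})$, $v\ge0$, is a martingale under $\mathbb{P}^{(x,t)}$ (with respect to the filtration generated by the stopped process $X_{v\wedge\tau_D}$) for every $(x,t)\in D$. $\|f\|_\infty$ is the supremum norm of $f$ over $\mathbb{R}^d\times\mathbb{R}^+$. *)

(* Defs.v *)
From HB Require Import structures.
From mathcomp Require Import all_boot all_order all_algebra.
From mathcomp Require Import all_classical all_reals all_analysis.

Set Implicit Arguments.
Unset Strict Implicit.
Unset Printing Implicit Defensive.

Import Order.TTheory GRing.Theory Num.Theory.
Import numFieldNormedType.Exports.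

Local Open Scope classical_set_scope.
Local Open Scope ring_scope.

Definition borel (T : topologicalType) : set (set T) := <<s @open T >>.
Arguments borel T : clear implicits.

Section euclidean.
Context {R : realType} {d : nat}.

Definition dotv (x y : 'rV[R]_d) : R := \sum_(i < d) x ord0 i * y ord0 i.

(* The norm of the library on row vectors is the maximum norm. *)
Definition eucl_norm (x : 'rV[R]_d) : R := Num.sqrt (dotv x x).

Definition eucl_dist (p q : 'rV[R]_d * R) : R :=
  Num.sqrt (eucl_norm (p.1 - q.1) ^+ 2 + (p.2 - q.2) ^+ 2).

Definition halfspace : set ('rV[R]_d * R) := [set p | 0 <= p.2].

Definition box (alpha r : R) (p : 'rV[R]_d * R) : set ('rV[R]_d * R) :=
  [set q : 'rV[R]_d * R |
    (forall i, `|p.1 ord0 i - q.1 ord0 i| < r `^ (2 / alpha) / 2) /\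
    `|q.2 - p.2| < r / 2].

Definition sup_norm (f : 'rV[R]_d * R -> R) : R :=
  sup [set `|f p| | p in halfspace].

Definition holder_continuous_on (A : set ('rV[R]_d * R))
    (f : 'rV[R]_d * R -> R) : Prop :=
  exists gamma C : R, [/\ 0 < gamma, gamma <= 1, 0 <= C &
    forall p q, A p -> A q -> `|f p - f q| <= C * eucl_dist p q `^ gamma].

End euclidean.
Arguments halfspace {R} d.

(* Processes are indexed by R, but only their values at times v >= 0 matter.
   The sigma-algebra SV on the state space is always the Borel one below. *)
Section processes.
Context {R : realType} {dO : measure_display} {Omega : measurableType dO}.
Variable P : probability Omega R.

Definition process_measurable {V : Type} (SV : set (set V))
    (X : R -> Omega -> V) : Prop :=
  forall v, 0 <= v -> forall B, SV B -> measurable (X v @^-1` B).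

(* The sigma-algebra generated by the X_v, v in I. *)
Definition process_sigma {V : Type} (SV : set (set V))
    (X : R -> Omega -> V) (I : set R) : set (set Omega) :=
  <<s [set A | exists2 v, I v & exists2 B, SV B & A = X v @^-1` B] >>.

Definition natural_filtration {V : Type} (SV : set (set V))
    (X : R -> Omega -> V) (v : R) : set (set Omega) :=
  process_sigma SV X [set r | 0 <= r <= v].

Definition independent_processes {V W : Type}
    (SV : set (set V)) (X : R -> Omega -> V)
    (SW : set (set W)) (X' : R -> Omega -> W) : Prop :=
  forall A B, process_sigma SV X [set r | 0 <= r] A ->
    process_sigma SW X' [set r | 0 <= r] B ->
    (P (A `&` B) = P A * P B)%E.

(* The sets B i may be the whole space, so the product rule over all n
   increments contains the one over every subfamily. *)
Definition independent_increments {V : zmodType} (SV : set (set V))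
    (X : R -> Omega -> V) : Prop :=
  forall (n : nat) (r : nat -> R) (B : 'I_n -> set V),
    0 <= r 0%N -> (forall i, r i <= r i.+1) -> (forall i, SV (B i)) ->
    P [set w | forall i : 'I_n, B i (X (r i.+1) w - X (r i) w)] =
    (\prod_(i < n) P [set w | B i (X (r i.+1) w - X (r i) w)%R])%E.

Definition stationary_increments {V : zmodType} (SV : set (set V))
    (X : R -> Omega -> V) : Prop :=
  forall s v B, 0 <= s -> s <= v -> SV B ->
    P [set w | B (X v w - X s w)] = P [set w | B (X (v - s) w - X 0 w)].

(* The characteristic function exp (- v |xi|^alpha) is given through its real
   and imaginary parts. *)
Definition symmetric_stable_process {d : nat} (alpha : R)
    (Y : R -> Omega -> 'rV[R]_d) : Prop :=
  [/\ process_measurable (borel 'rV[R]_d) Y,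
      (forall w, Y 0 w = 0),
      (forall w v, 0 <= v -> Y r w @[r --> v^'+] --> Y v w),
      independent_increments (borel 'rV[R]_d) Y /\
      stationary_increments (borel 'rV[R]_d) Y &
      forall v (xi : 'rV[R]_d), 0 <= v ->
        ('E_P[fun w => cos (dotv xi (Y v w))] =
          (expR (- (v * eucl_norm xi `^ alpha)))%:E)%E /\
        ('E_P[fun w => sin (dotv xi (Y v w))] = 0)%E].

(* The second parameter of normal_prob is the standard deviation, so that
   Z_v - Z_s has variance 2 (v - s). *)
Definition brownian_motion (Z : R -> Omega -> R) : Prop :=
  [/\ process_measurable (borel R) Z,
      (forall w, Z 0 w = 0),
      (forall w, {within [set v | 0 <= v], continuous (Z ^~ w)}),
      independent_increments (borel R) Z &
      forall s v B, 0 <= s -> s < v -> borel R B ->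
        P [set w | B (Z v w - Z s w)] =
        normal_prob 0 (Num.sqrt (2 * (v - s))) B].

(* The value is +oo when X never leaves A. *)
Definition exit_time {V : Type} (X : R -> Omega -> V) (A : set V)
    (w : Omega) : \bar R :=
  ereal_inf [set v%:E | v in [set v : R | 0 <= v /\ ~ A (X v w)]].

Definition stopped {V : Type} (X : R -> Omega -> V) (tau : Omega -> \bar R)
    (v : R) (w : Omega) : V :=
  X (fine (mine v%:E (tau w))) w.

Definition filtration (F : R -> set (set Omega)) : Prop :=
  [/\ forall v, 0 <= v -> sigma_algebra setT (F v),
      forall v, 0 <= v -> F v `<=` measurable &
      forall s v, 0 <= s -> s <= v -> F s `<=` F v].

(* The last clause is E[M_v | F_s] = M_s, written out by the defining property
   of the conditional expectation. *)
Definition martingale (F : R -> set (set Omega)) (M : R -> Omega -> R) : Prop :=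
  [/\ filtration F,
      forall v, 0 <= v -> forall B, borel R B -> F v (M v @^-1` B),
      forall v, 0 <= v -> P.-integrable setT (EFin \o M v) &
      forall s v A, 0 <= s -> s <= v -> F s A ->
        (\int[P]_(w in A) (M v w)%:E = \int[P]_(w in A) (M s w)%:E)%E].

Context {d : nat}.
Variables (Y : R -> Omega -> 'rV[R]_d) (Z : R -> Omega -> R).

(* The law of product_process p under P is that of X = (Y, Z) under P^p. *)
Definition product_process (p : 'rV[R]_d * R) (v : R) (w : Omega) :
  'rV[R]_d * R := (p.1 + Y v w, p.2 + Z v w).

Definition stopped_product (D : set ('rV[R]_d * R)) (p : 'rV[R]_d * R) :
    R -> Omega -> 'rV[R]_d * R :=
  stopped (product_process p) (exit_time (product_process p) D).

(* A function on the half-space is represented by a total function whose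
   values outside the half-space are irrelevant: Z has continuous paths, so
   the process stopped on leaving D stays in the half-space when D is an open
   box contained in it. *)
Definition harmonic_on (D : set ('rV[R]_d * R))
    (u : 'rV[R]_d * R -> R) : Prop :=
  [/\ forall B, borel R B ->
        borel ('rV[R]_d * R)%type (halfspace d `&` u @^-1` B),
      {within D, continuous u} &
      forall p, D p ->
        martingale
          (natural_filtration (borel ('rV[R]_d * R)%type) (stopped_product D p))
          (fun v => u \o stopped_product D p v)].

End processes.

(* Main.v *)
Require Import Defs.
From HB Require Import structures.
From mathcomp Require Import all_boot all_order all_algebra.
From mathcomp Require Import all_classical all_reals all_analysis.
From mathcomp Require Import measurable_realfun zify ring lra.

Set Implicit Arguments.
Unset Strict Implicit.
Unset Printing Implicit Defensive.

Import Order.TTheory GRing.Theory Num.Theory.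
Import numFieldNormedType.Exports.

Local Open Scope classical_set_scope.
Local Open Scope ring_scope.

(** A bounded harmonic function [f] on the large box satisfies
    [f p = E (f (X stopped at time T))] for every [T], by the martingale
    property at the times [0] and [T]. For a short time [T] the process started
    in the small box has not left the large one, up to an event of probability
    at most [C * T]; so up to [C * T * sup_norm f] the value [f p] is the
    expectation of [f] at the unstopped process. That expectation is smooth in
    the starting point, because the law of [X T] is: moving the starting point
    by [r] changes it by at most [C * r * T ^- q * sup_norm f], for [T] at most
    one. The choice [T ^+ q.+1 = r] balances the two errors and gives Hölder continuity with
    exponent [(q.+1)^-1].

    The probability of leaving early is bounded with Ottaviani's inequality
    ([ottaviani], [maximal_inequality]), which reduces it to the tails of single
    increments. For the stable process these follow from the characteristic
    function: on each dyadic shell the function [1 - cos (u * y)] of a suitable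
    frequency [u] is bounded below ([cos_tail_bound]).

    In the last coordinate the smoothness of the law is a comparison of
    Gaussian densities ([mean_normal_shift]). The stable law is only given by
    its characteristic function. To avoid inverting it, [f] is replaced, in the
    first coordinates, by its convolution with a Fejer kernel on a grid of the
    torus. By Korovkin's argument these averages tend to [f] inside the
    fundamental cube ([kern_approx]), the only place where the process is while
    it has not left early ([smoothed_approximates]). They are trigonometric
    polynomials, so their expectation is explicit, with each frequency [m]
    damped by [expR (- (T * |m| `^ alpha))] ([mean_kern]); as the damping factors
    are summable against [|m|] over the whole lattice, the expectation is
    Lipschitz in the starting point with a constant that depends neither on the
    grid nor on the modulus of continuity of [f] ([mean_kern_lipschitz],
    [translation_estimate]). *)


(** * Expectations of bounded random variables *)

Section bounded_rv.
Context {dO : measure_display} {Omega : measurableType dO} {R : realType}.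
Variable P : probability Omega R.
Implicit Types U V : Omega -> R.

Definition bounded_rv U :=
  measurable_fun setT U /\ exists M : R, forall w, `|U w| <= M.

Lemma bounded_rv_integrable U : bounded_rv U -> P.-integrable setT (EFin \o U).
Proof.
move=> [mU [M UM]]; apply: (@le_integrable _ _ _ _ _ _ _ (EFin \o cst M)) => //.
- exact/measurable_EFinP.
- by move=> w _ /=; rewrite lee_fin (le_trans (UM w))// ler_norm.
- exact: finite_measure_integrable_cst.
Qed.

Lemma bounded_rv_cst (c : R) : bounded_rv (fun=> c).
Proof. by split; [exact: measurable_cst | exists `|c|]. Qed.

Lemma bounded_rvD U V :
  bounded_rv U -> bounded_rv V -> bounded_rv (fun w => U w + V w).
Proof.
move=> [mU [M UM]] [mV [N VN]]; split; first exact: measurable_funD.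
by exists (M + N) => w; rewrite (le_trans (ler_normD _ _))// lerD.
Qed.

Lemma bounded_rvM U V :
  bounded_rv U -> bounded_rv V -> bounded_rv (fun w => U w * V w).
Proof.
move=> [mU [M UM]] [mV [N VN]]; split; first exact: measurable_funM.
by exists (M * N) => w; rewrite normrM ler_pM.
Qed.

Lemma bounded_rvZ c U : bounded_rv U -> bounded_rv (fun w => c * U w).
Proof. by move=> bU; apply: bounded_rvM => //; exact: bounded_rv_cst. Qed.

Lemma bounded_rvB U V :
  bounded_rv U -> bounded_rv V -> bounded_rv (fun w => U w - V w).
Proof.
move=> bU /(bounded_rvZ (-1)) bV; have := bounded_rvD bU bV.
by under eq_fun do rewrite mulN1r.
Qed.

Lemma bounded_rv_norm U : bounded_rv U -> bounded_rv (fun w => `|U w|).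
Proof.
move=> [mU [M UM]]; split; first exact: measurableT_comp.
by exists M => w; rewrite normr_id.
Qed.

Lemma bounded_rv_sum (I : Type) (r : seq I) (F : I -> Omega -> R) :
  (forall i, bounded_rv (F i)) -> bounded_rv (fun w => \sum_(i <- r) F i w).
Proof.
move=> bF; elim: r => [|i r IH].
  by under eq_fun do rewrite big_nil; exact: bounded_rv_cst.
by under eq_fun do rewrite big_cons; exact: bounded_rvD.
Qed.

Lemma mean_cst (c : R) : \int[P]_w c = c.
Proof. by rewrite Rintegral_cst//= probability_setT mulr1. Qed.

Lemma mean_sum (I : Type) (r : seq I) (F : I -> Omega -> R) :
    (forall i, bounded_rv (F i)) ->
  \int[P]_w (\sum_(i <- r) F i w) = \sum_(i <- r) \int[P]_w F i w.
Proof.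
move=> bF; elim: r => [|i r IH].
  under eq_Rintegral do rewrite big_nil.
  by rewrite big_nil mean_cst.
under eq_Rintegral do rewrite big_cons.
rewrite big_cons RintegralD// ?IH//; apply: bounded_rv_integrable => //.
exact: bounded_rv_sum.
Qed.

Lemma meanB U V : bounded_rv U -> bounded_rv V ->
  \int[P]_w (U w - V w) = \int[P]_w U w - \int[P]_w V w.
Proof. by move=> bU bV; rewrite RintegralB//; exact: bounded_rv_integrable. Qed.

Lemma meanZ c U : bounded_rv U -> \int[P]_w (c * U w) = c * \int[P]_w U w.
Proof. by move=> bU; rewrite RintegralZl//; exact: bounded_rv_integrable. Qed.

Lemma le_mean U V : bounded_rv U -> bounded_rv V ->
  (forall w, U w <= V w) -> \int[P]_w U w <= \int[P]_w V w.
Proof. by move=> bU bV UV; apply: le_Rintegral => //; exact: bounded_rv_integrable. Qed.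

Lemma norm_mean_le U M : bounded_rv U -> (forall w, `|U w| <= M) ->
  `|\int[P]_w U w| <= M.
Proof.
move=> bU UM; apply: le_trans (le_normr_Rintegral _ _) _ => //.
  exact: bounded_rv_integrable.
rewrite -[leRHS]mean_cst; apply: le_mean => //; first exact: bounded_rv_norm.
exact: bounded_rv_cst.
Qed.

Lemma mean_indic (A : set Omega) : measurable A ->
  \int[P]_w \1_A w = fine (P A).
Proof. by move=> mA; rewrite /Rintegral integral_indic// setIT. Qed.

Lemma bounded_rv_indic (A : set Omega) : measurable A -> bounded_rv \1_A.
Proof.
move=> mA; split; first exact: measurable_indic.
by exists 1 => w; rewrite indicE normr_nat lern1 leq_b1.
Qed.

(** The joint law of independent variables is the product of their laws, so
    Fubini's theorem computes the expectation. *)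
Lemma mean_mul_indep U V : bounded_rv U -> bounded_rv V ->
    (forall A B : set R, measurable A -> measurable B ->
      (P (U @^-1` A `&` V @^-1` B) = P (U @^-1` A) * P (V @^-1` B))%E) ->
  \int[P]_w (U w * V w) = \int[P]_w U w * \int[P]_w V w.
Proof.
move=> bU bV UV; have [mU _] := bU; have [mV _] := bV.
pose mUm := isMeasurableFun.Build _ _ _ _ _ mU.
pose U' : {mfun Omega >-> R} := HB.pack U mUm.
pose mVm := isMeasurableFun.Build _ _ _ _ _ mV.
pose V' : {mfun Omega >-> R} := HB.pack V mVm.
have mUV : measurable_fun setT (fun w => (U w, V w)).
  exact: measurable_fun_pair.
pose mUVm := isMeasurableFun.Build _ _ _ _ _ mUV.
pose UV' : {mfun Omega >-> (R * R)%type} := HB.pack (fun w => (U w, V w)) mUVm.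
pose m1 := distribution P U'; pose m2 := distribution P V'.
have E : forall X : set (R * R), measurable X ->
    (m1 \x m2)%E X = distribution P UV' X.
  apply: product_measure_unique => A B mA mB /=.
  by rewrite /distribution /= /pushforward /= -UV//.
pose f (z : R * R) : \bar R := (z.1 * z.2)%:E.
have mf : measurable_fun setT f.
  by apply/measurable_EFinP; apply: measurable_funM.
have iUV : P.-integrable setT (f \o UV').
  exact: (bounded_rv_integrable (bounded_rvM bU bV)).
have if0 : (distribution P UV').-integrable setT f.
  exact: integrable_pushforward.
have if12 : (m1 \x m2)%E.-integrable setT f.
  apply/integrableP; split => //.
  rewrite (@eq_measure_integral _ _ _ _ (distribution P UV')).
    by case/integrableP : if0.
  by move=> A mA _; exact: E.
have -> : \int[P]_w (U w * V w) = fine (\int[m1 \x m2]_z f z).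
  rewrite /Rintegral; congr fine.
  rewrite (@eq_measure_integral _ _ _ _ (distribution P UV')); last first.
    by move=> A mA _; exact: E.
  by rewrite integral_distribution.
rewrite -(integral12_prod_meas1 if12).
have iV : m2.-integrable setT EFin.
  apply: integrable_pushforward => //.
  exact: bounded_rv_integrable.
have iU : m1.-integrable setT EFin.
  apply: integrable_pushforward => //.
  exact: bounded_rv_integrable.
have EV : (\int[m2]_y (y%:E) = (\int[P]_w V w)%:E)%E.
  rewrite integral_distribution//; last exact: bounded_rv_integrable.
  rewrite /Rintegral fineK//; apply: integrable_fin_num => //.
  exact: bounded_rv_integrable.
have EU : (\int[m1]_y (y%:E) = (\int[P]_w U w)%:E)%E.
  rewrite integral_distribution//; last exact: bounded_rv_integrable.
  rewrite /Rintegral fineK//; apply: integrable_fin_num => //.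
  exact: bounded_rv_integrable.
rewrite (_ : fubini_F _ _ = fun x => ((\int[P]_w V w)%:E * x%:E)%E); last first.
  apply/funext => x; rewrite /fubini_F /f /=.
  under eq_integral do rewrite EFinM.
  by rewrite integralZl//= EV muleC.
by rewrite integralZl//= EU /= mulrC.
Qed.

End bounded_rv.

(** * Borel sets *)

Lemma borel_measurable (R : realType) : borel R = @measurable _ R.
Proof.
apply/seteqP; split.
  apply: smallest_sub; first exact: sigma_algebra_measurable.
  exact: open_measurable.
have -> : @measurable _ R = _ := RGenOpens.measurableE R.
apply: smallest_sub; first exact: smallest_sigma_algebra.
by move=> _ [a [b ->]]; apply: sub_sigma_algebra; exact: interval_open.
Qed.

Lemma borel_preimage (T T' : topologicalType) (f : T -> T') B :
  continuous f -> borel T' B -> borel T (f @^-1` B).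
Proof.
move=> /continuousP cf bB.
suff : borel T' `<=` [set B | borel T (f @^-1` B)] by exact.
apply: smallest_sub; last by move=> O oO; apply: sub_sigma_algebra; exact: cf.
have [s0 sC sU] : sigma_algebra setT (borel T) by exact: smallest_sigma_algebra.
split => [|A /sC|F bF]; rewrite /mkset.
- by rewrite preimage_set0.
- by rewrite !setTD preimage_setC.
- by rewrite preimage_bigcup; exact: sU.
Qed.

(** * A maximal inequality for processes with independent increments *)

Lemma measurable_far d (T : measurableType d) (R : realType) (b : R) (U : T -> R) :
  measurable_fun setT U -> measurable [set w | b < `|U w|].
Proof.
move=> mU; have := measurableT_comp (@normr_measurable R setT) mU.
move=> /(_ measurableT _ (measurable_itv `]b, +oo[)); rewrite setTI.
by rewrite preimage_itvoy.
Qed.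

Lemma measurable_exceeds d (T : measurableType d) (R : realType) (b : R)
    (U : nat -> T -> R) k :
  (forall j, (j <= k)%N -> measurable_fun setT (U j)) ->
  measurable [set w | exists2 j, (j <= k)%N & b < `|U j w|].
Proof.
move=> mU; rewrite (_ : [set _ | _] =
    \bigcup_(j in [set j | (j <= k)%N]) [set w | b < `|U j w|]).
  by apply: bigcup_measurable => j jk; apply: measurable_far; exact: mU.
by apply/seteqP; split => w [j ? ?]; exists j.
Qed.

Section past_independence.
Context {dO : measure_display} {Omega : measurableType dO} {R : realType}.
Variable P : probability Omega R.

(** Two finite measures that agree on a pi-system agree on the sigma-algebra that
    it generates; here they are the restriction of [P] to [D] and the multiple
    of [P] by [P D]. *)
Lemma indep_g_sigma_algebra (G : set (set Omega)) (D : set Omega) :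
    G `<=` measurable -> setI_closed G -> measurable D ->
    (forall A, G A -> P (A `&` D) = (P A * P D)%E) ->
  forall A, <<s G >> A -> P (A `&` D) = (P A * P D)%E.
Proof.
move=> Gm GI mD GD A sA.
have p0 : 0 <= fine (P D) by rewrite fine_ge0.
have HT : [set X | G X /\ X `<=` setT] = G.
  by apply/seteqP; split=> [X []//|X GX]; split.
pose m2 : {measure set Omega -> \bar R} := mscale (NngNum p0) P.
have m2E X : m2 X = (P X * P D)%E.
  by rewrite /m2 /= /mscale /= fineK ?fin_num_measure// muleC.
rewrite -m2E.
apply: (@g_sigma_algebra_measure_unique_trace _ _ _ G setT measurableT _ _
  (mrestr P mD) m2); rewrite ?HT//=.
- by rewrite /mrestr m2E setTI probability_setT mul1e.
- by move=> B GB; rewrite /mrestr m2E GD.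
- by rewrite /mrestr (le_lt_trans (probability_le1 _ _))// ?ltry//; exact: measurableI.
Qed.

Variable W : R -> Omega -> R.
Hypothesis mW : forall v, 0 <= v -> measurable_fun setT (W v).
Hypothesis W0 : forall w, W 0 w = 0.
Hypothesis iW : independent_increments P (borel R) W.

Section grid.
Variable r : nat -> R.
Hypothesis r0 : r 0%N = 0.
Hypothesis r_nd : forall i, r i <= r i.+1.

Let r_ge0 i : 0 <= r i.
Proof. by elim: i => [|i IH]; [rewrite r0 | rewrite (le_trans IH)]. Qed.

Let incr i w := W (r i.+1) w - W (r i) w.

Let mincr i : measurable_fun setT (incr i).
Proof. by apply: measurable_funB; exact: mW. Qed.

(** The rectangles in the first [k] increments; they are stable under
    intersection, and generate the past of the grid up to [r k]. *)
Definition past_rect (k : nat) : set (set Omega) :=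
  [set A | exists2 B : nat -> set R, (forall i, measurable (B i)) &
    A = [set w | forall i : 'I_k, B i (W (r i.+1) w - W (r i) w)]].

Let measurable_rect k (B : nat -> set R) : (forall i, measurable (B i)) ->
  measurable [set w | forall i : 'I_k, B i (incr i w)].
Proof.
move=> mB; rewrite (_ : [set _ | _] = \big[setI/setT]_(i < k) (incr i @^-1` B i)).
  apply: bigsetI_measurable => i _; rewrite -[X in measurable X]setTI.
  exact: mincr.
rewrite -(bigcap_mkord k (fun i => incr i @^-1` B i)); apply/seteqP; split => w /=.
  by move=> h i ik; exact: (h (Ordinal ik)).
by move=> h i; exact: (h i (ltn_ord i)).
Qed.

(** A rectangle in the increments up to [r k], cut by a condition on the increment
    from [r k] to [s], is a rectangle in the increments of the grid that jumps
    to [s] after [r k]. *)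
Lemma indep_past k s C A : r k <= s -> measurable C -> <<s past_rect k >> A ->
  P (A `&` [set w | C (W s w - W (r k) w)]) =
    (P A * P [set w | C (W s w - W (r k) w)%R])%E.
Proof.
move=> rks mC; apply: indep_g_sigma_algebra.
- by move=> _ [B mB ->]; exact: measurable_rect.
- move=> _ _ [B mB ->] [B' mB' ->]; exists (fun i => B i `&` B' i).
    by move=> i; exact: measurableI.
  apply/seteqP; split => w /=; first by move=> [h h'] i; split.
  by move=> h; split => i; have [] := h i.
- have mWW : measurable_fun setT (fun w => W s w - W (r k) w).
    by apply: measurable_funB; apply: mW => //; exact: le_trans (r_ge0 k) rks.
  by have := mWW measurableT C mC; rewrite setTI.
- move=> _ [B mB ->].
  pose r' i := if (i <= k)%N then r i else s.
  pose B' i := if (i < k)%N then B i else C.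
  have bB' i : borel R (B' i) by rewrite borel_measurable /B'; case: ifP.
  have r'0 : 0 <= r' 0%N by rewrite /r' leq0n r0.
  have r'_nd i : r' i <= r' i.+1.
    rewrite /r'; have [ik|ik] := ltnP i k; first by rewrite (ltnW ik).
    by case: ifP => // ik'; have -> : i = k by apply/eqP; rewrite eqn_leq ik ik'.
  have EB (i : 'I_k) w : B' i (W (r' i.+1) w - W (r' i) w) =
      B i (W (r i.+1) w - W (r i) w).
    by rewrite /B' /r' ltn_ord ltnW.
  have EC w : B' k (W (r' k.+1) w - W (r' k) w) = C (W s w - W (r k) w).
    by rewrite /B' /r' ltnn leqnn.
  have := iW (n := k.+1) (r := r') (B := fun i => B' i) r'0 r'_nd (fun i => bB' i).
  rewrite big_ord_recr /=.
  under eq_bigr do under eq_set do rewrite EB.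
  have bB (i : 'I_k) : borel R (B i) by rewrite borel_measurable.
  have rr0 : 0 <= r 0%N by rewrite r0.
  rewrite -(iW (n := k) (r := r) (B := fun i => B i) rr0 r_nd bB) => E.
  rewrite (_ : [set w | B' k _] = [set w | C (W s w - W (r k) w)]) in E; last first.
    by apply/funext => w; rewrite /mkset EC.
  rewrite -E; congr (P _); apply/seteqP; split => w /=.
    move=> [h c] i; have [ik|] := ltnP i k.
      by have := EB (Ordinal ik) w; rewrite /= => ->; exact: (h (Ordinal ik)).
    move=> ki; have -> : nat_of_ord i = k.
      by apply/eqP; rewrite eqn_leq ki -ltnS ltn_ord.
    by rewrite EC.
  move=> h; split; first by move=> i; rewrite -EB; exact: (h (widen_ord (leqnSn k) i)).
  by rewrite -EC; exact: (h ord_max).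
Qed.

Let past_meas k j : (j <= k)%N ->
  measurable_fun (setT : set (g_sigma_algebraType (past_rect k))) (W (r j)).
Proof.
elim: j => [_|j IH jk].
  rewrite (_ : W _ = cst 0); first exact: measurable_cst.
  by apply/funext => w; rewrite r0 W0.
rewrite (_ : W _ = (W (r j) \+ incr j)); last first.
  by apply/funext => w; rewrite /incr /= addrC subrK.
apply: measurable_funD; first by apply: IH; exact: ltnW.
move=> _ B mB; rewrite setTI; apply: sub_sigma_algebra.
exists (fun i => if i == j then B else setT); first by move=> i; case: ifP.
apply/seteqP; split => w /=; first by move=> h i; case: eqP => // ->.
by move=> /(_ (Ordinal jk)) /=; rewrite eqxx.
Qed.

Section ottaviani.
Variables (n : nat) (a : R).
Hypothesis a0 : 0 <= a.
Hypothesis half : forall k, (k <= n)%N ->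
  fine (P [set w | a < `|W (r n) w - W (r k) w|]) <= 2^-1.

Let r_le i j : (i <= j)%N -> r i <= r j.
Proof.
by move=> ij; rewrite -(subnK ij); elim: (j - i)%N => // k IH; rewrite (le_trans IH).
Qed.

Let far := [set w | a < `|W (r n) w|].

Let ex k : set Omega := [set w | exists2 j, (j <= k)%N & 2 * a < `|W (r j) w|].

(** Split [ex k] according to the first index at which the path is far out.
    What happens after this index is independent of the past, so with
    probability at least one half the path stays within [a] of its position
    up to the final time, where it is then still far out. *)
Let first_passage k : (k <= n)%N -> fine (P (ex k)) <= 2 * fine (P (ex k `&` far)).
Proof.
have mex k0 : measurable (ex k0) by apply: measurable_exceeds => j _; exact: mW.
have mfar : measurable far by apply: measurable_far; exact: mW.
elim: k => [_|k IH kn].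
  rewrite (_ : ex 0 = set0) ?measure0 ?mulr_ge0 ?fine_ge0//.
  apply/seteqP; split => // w [j]; rewrite leqn0 => /eqP ->.
  by rewrite r0 W0 normr0 ltNge mulr_ge0.
pose A := [set w | 2 * a < `|W (r k.+1) w|] `\` ex k.
have mA : measurable A.
  by apply: measurableD => //; apply: measurable_far; exact: mW.
have sA : <<s past_rect k.+1 >> A.
  have : measurable (A : set (g_sigma_algebraType (past_rect k.+1))) by
    apply: measurableD; [apply: measurable_far | apply: measurable_exceeds => j jk];
    apply: past_meas => //; exact: leqW.
  by [].
have exS : ex k.+1 = ex k `|` A.
  apply/seteqP; split => w.
    move=> [j jk fj]; have [?|nk] := pselect (ex k w); first by left.
    right; split => //=; move: jk; rewrite leq_eqVlt ltnS => /predU1P[<-//|jk].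
    by case: nk; exists j.
  by case=> [[j jk ?]|[/= ? _]]; [exists j => //; exact: leqW | exists k.+1].
have exA : ex k `&` A = set0 by apply/seteqP; split => // w [? [_]].
pose D := [set w | [set x | `|x| <= a] (W (r n) w - W (r k.+1) w)].
have mC : measurable [set x : R | `|x| <= a].
  rewrite (_ : [set x | _] = `[- a, a]%classic); first exact: measurable_itv.
  by apply/seteqP; split => x /=; rewrite in_itv /= ler_norml.
have mWW : measurable_fun setT (fun w => W (r n) w - W (r k.+1) w).
  by apply: measurable_funB; exact: mW.
have mD : measurable D by have := mWW measurableT _ mC; rewrite setTI.
have AD : fine (P (A `&` D)) = fine (P A) * fine (P D).
  by rewrite (indep_past (r_le kn) mC sA) fineM ?fin_num_measure.
have PD : 2^-1 <= fine (P D).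
  have -> : D = ~` [set w | a < `|W (r n) w - W (r k.+1) w|].
    by apply/seteqP; split => w; rewrite /D /= leNgt => /negP.
  have mB : measurable [set w | a < `|W (r n) w - W (r k.+1) w|].
    exact: measurable_far.
  rewrite probability_setC// fineB ?fin_num_measure//=.
  by have := half kn; lra.
have mAF : measurable (A `&` far) by exact: measurableI.
have ADF : fine (P (A `&` D)) <= fine (P (A `&` far)).
  apply: fine_le; rewrite ?fin_num_measure//; first exact: measurableI.
  apply: le_measure; rewrite ?inE//; first exact: measurableI.
  move=> w [[Aw exw] /= Dw]; split=> //; rewrite /far /=.
  have {}Aw : 2 * a < `|W (r k.+1) w| := Aw.
  have {}Dw : `|W (r n) w - W (r k.+1) w| <= a := Dw.
  by have := lerB_dist (W (r k.+1) w) (W (r n) w); rewrite distrC; lra.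
have meq (X Y : set Omega) : measurable X -> measurable Y -> X `&` Y = set0 ->
    fine (P (X `|` Y)) = fine (P X) + fine (P Y).
  by move=> mX mY XY; rewrite measureU// fineD ?fin_num_measure.
have -> : fine (P (ex k.+1)) = fine (P (ex k)) + fine (P A) by rewrite exS meq.
have -> : fine (P (ex k.+1 `&` far)) =
    fine (P (ex k `&` far)) + fine (P (A `&` far)).
  rewrite exS setIUl meq//; first exact: measurableI.
  by rewrite setIACA exA set0I.
have PA0 : 0 <= fine (P A) by rewrite fine_ge0.
have := IH (ltnW kn).
have : fine (P A) * 2^-1 <= fine (P A) * fine (P D) by exact: ler_wpM2l.
by rewrite -AD; lra.
Qed.

Lemma ottaviani : fine (P (ex n)) <= 2 * fine (P far).
Proof.
apply: le_trans (first_passage (leqnn n)) _; rewrite ler_pM2l//.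
have mfar : measurable far by apply: measurable_far; exact: mW.
have mex : measurable (ex n) by apply: measurable_exceeds => j _; exact: mW.
apply: fine_le; rewrite ?fin_num_measure//; first exact: measurableI.
by apply: le_measure; rewrite ?inE//; exact: measurableI.
Qed.

End ottaviani.
End grid.

(** Some value of the path at a dyadic fraction of [T] is larger than [b]; for
    a right-continuous path this is the event that its supremum over the times
    up to [T] is larger than [b]. *)
Definition exceeds_dyadic (X : R -> Omega -> R) (T b : R) : set Omega :=
  [set w | exists m j, (j <= 2 ^ m)%N /\ b < `|X (T * j%:R / 2 ^+ m) w|].

Section dyadic.
Variables (T a C : R).
Hypotheses (T0 : 0 <= T) (a0 : 0 <= a) (C0 : 0 <= C) (CT : C * T <= 2^-1).
Hypothesis tail : forall s v, 0 <= s -> s <= v -> v <= T ->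
  fine (P [set w | a < `|W v w - W s w|]) <= C * (v - s).

Let grid m i : R := T * i%:R / 2 ^+ m.

Let gridT m : grid m (2 ^ m) = T.
Proof. by rewrite /grid natrX mulfK// expf_neq0. Qed.

Let grid_nd m i : grid m i <= grid m i.+1.
Proof. by rewrite /grid ler_pM2r ?invr_gt0 ?exprn_gt0// ler_wpM2l// ler_nat. Qed.

Let grid0 m : grid m 0 = 0. Proof. by rewrite /grid mulr0 mul0r. Qed.

Let E m := [set w | exists2 j, (j <= 2 ^ m)%N & 2 * a < `|W (grid m j) w|].

Let grid_ge0 m i : 0 <= grid m i.
Proof. by rewrite divr_ge0 ?mulr_ge0// exprn_ge0. Qed.

Let mE m : measurable (E m).
Proof. by apply: measurable_exceeds => j _; exact: mW. Qed.

Let exceedsE : exceeds_dyadic W T (2 * a) = \bigcup_m E m.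
Proof.
apply/seteqP; split => w; first by move=> [m [j [jm ?]]]; exists m => //; exists j.
by move=> [m _ [j ? ?]]; exists m, j.
Qed.

Lemma measurable_exceeds_dyadic : measurable (exceeds_dyadic W T (2 * a)).
Proof. by rewrite exceedsE; exact: bigcupT_measurable. Qed.

(** Along a fixed grid this is [ottaviani]; the bound does not depend on the
    grid, and the dyadic grids increase. *)
Lemma maximal_inequality : fine (P (exceeds_dyadic W T (2 * a))) <= 2 * C * T.
Proof.
have tailT s : 0 <= s -> s <= T ->
    fine (P [set w | a < `|W T w - W s w|]) <= C * T.
  move=> s0 sT; apply: le_trans (tail s0 sT (lexx T)) _.
  by rewrite ler_wpM2l// lerBlDr lerDl.
have PE m : (P (E m) <= (2 * C * T)%:E)%E.
  rewrite -(@fineK _ (P (E m))) ?fin_num_measure// lee_fin.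
  have gle k : (k <= 2 ^ m)%N -> grid m k <= T.
    move=> km; rewrite -[leRHS](gridT m) /grid ler_pM2r ?invr_gt0 ?exprn_gt0//.
    by rewrite ler_wpM2l// ler_nat.
  apply: le_trans (ottaviani (grid0 m) (grid_nd m) a0 _) _.
    by move=> k km; rewrite gridT; apply: le_trans (tailT _ _ (gle _ km)) _.
  rewrite gridT -mulrA ler_pM2l//.
  have := tailT 0 (lexx 0) T0.
  by under eq_set do rewrite W0 subr0.
rewrite exceedsE -lee_fin fineK ?fin_num_measure//; last exact: bigcupT_measurable.
have ndE : nondecreasing_seq E.
  apply/nondecreasing_seqP => m; apply/subsetPset => w [j jm Wj].
  exists (2 * j)%N; first by rewrite expnS leq_mul2l jm orbT.
  suff -> : grid m.+1 (2 * j) = grid m j by [].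
  by rewrite /grid natrM exprS invfM; field; rewrite expf_neq0.
have cE := nondecreasing_cvg_mu (mu := P) mE (bigcupT_measurable _ mE) ndE.
rewrite -(cvg_lim (@ereal_hausdorff R) cE).
apply: lime_le; first by apply/cvg_ex; eexists; exact: cE.
by apply: nearW => m; exact: PE.
Qed.

End dyadic.
End past_independence.

Section right_continuous_paths.
Context {R : realType}.

Lemma dyadic_dense (T s e : R) : 0 <= s -> s < T -> 0 < e ->
  exists m j, (j <= 2 ^ m)%N /\ s < T * j%:R / 2 ^+ m < s + e.
Proof.
move=> s0 sT e0; have T0 : 0 < T := le_lt_trans s0 sT.
pose e' := Num.min e (T - s).
have e'0 : 0 < e' by rewrite lt_min e0 subr_gt0.
have [m mP] : exists m, T / e' < 2 ^+ m :> R.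
  have := archi_boundP (ltW (divr_gt0 T0 e'0)).
  set m := Num.bound _ => mP; exists m; rewrite (lt_trans mP)//.
  by rewrite -natrX ltr_nat ltn_expl.
have p0 : 0 < 2 ^+ m :> R by exact: exprn_gt0.
(* [k.+1] is the first index whose grid point lies strictly after [s]. *)
pose k := Num.truncn (s * 2 ^+ m / T).
have x0 : 0 <= s * 2 ^+ m / T by rewrite divr_ge0 ?mulr_ge0// ltW.
have /andP[k1 k2] := truncn_itv x0.
have Te : T / 2 ^+ m < e'.
  by rewrite ltr_pdivrMr// mulrC -ltr_pdivrMr.
have g1 : s < T * k.+1%:R / 2 ^+ m.
  by rewrite ltr_pdivlMr// mulrC; move: k2; rewrite ltr_pdivrMr// mulrC [X in _ < X]mulrC.
have g2 : T * k.+1%:R / 2 ^+ m < s + e'.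
  apply: (@le_lt_trans _ _ (s + T / 2 ^+ m)); last by rewrite ltrD2l.
  rewrite -natr1 mulrDr mulr1 mulrDl lerD2r ler_pdivrMr//.
  by move: k1; rewrite ler_pdivlMr// mulrC.
have [ee eT] : e' <= e /\ e' <= T - s by rewrite !ge_min !lexx orbT.
exists m, k.+1; split; last by rewrite g1 (lt_le_trans g2)// lerD2l.
have : T * k.+1%:R / 2 ^+ m < T * 1 by rewrite mulr1; lra.
rewrite -mulrA ltr_pM2l// ltr_pdivrMr// mul1r -natrX ltr_nat.
exact: ltnW.
Qed.

Lemma right_continuous_dyadic_bound (g : R -> R) (T b : R) :
    (forall v, 0 <= v -> g r @[r --> v^'+] --> g v) ->
    (forall m j, (j <= 2 ^ m)%N -> `|g (T * j%:R / 2 ^+ m)| <= b) ->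
  forall s, 0 <= s -> s <= T -> `|g s| <= b.
Proof.
move=> gc gb s s0; rewrite le_eqVlt => /predU1P[->|sT].
  by have := gb 0%N 1%N isT; rewrite mulr1 expr0 divr1.
rewrite leNgt; apply/negP => bg.
have e0 : 0 < `|g s| - b by rewrite subr_gt0.
have := gc _ s0 => /cvgrPdist_lt /(_ _ e0).
rewrite near_withinE => /nbhs_ballP [e /= e'0 he].
have [m [j [jm /andP[sj js]]]] := dyadic_dense s0 sT e'0.
have := gb m j jm; rewrite leNgt => /negP; apply.
have bj : ball s e (T * j%:R / 2 ^+ m).
  by rewrite /ball /= distrC ltr_distl; apply/andP; split; lra.
have := he _ bj sj.
by have := lerB_dist (g s) (g (T * j%:R / 2 ^+ m)); lra.
Qed.

End right_continuous_paths.

(** * Gaussian laws *)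

Section gaussian.
Context {R : realType}.
Local Notation mu := (@lebesgue_measure R).
Implicit Types (m t s a x : R).

Lemma lebesgue_measure_translation t (A : set R) : measurable A ->
  pushforward mu ((fun x => t + x) : _ -> measurableTypeR R) A = mu A.
Proof.
move=> mA; apply/esym/lebesgue_measure_unique => //= [|_ _ [[a b]] _ <-].
  exact: measurable_funD.
rewrite /pushforward (_ : _ @^-1` _ = `]a - t, b - t]%classic); last first.
  by apply/seteqP; split => x /=; rewrite !in_itv /= ltrBlDl lerBrDl.
by rewrite !lebesgue_measure_itv/= !lte_fin ltrD2r -!EFinB opprB addrA subrK.
Qed.

(** The case [s = 0] is excluded, as [normal_prob t 0] is a uniform law that
    does not move with [t]. *)
Lemma normal_prob_translation t s (B : set R) : s != 0 -> measurable B ->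
  normal_prob 0 s ((fun x => t + x) @^-1` B) = normal_prob t s B.
Proof.
move=> s0 mB; rewrite /normal_prob.
pose phi : R -> measurableTypeR R := fun x => t + x.
have mphi : measurable_fun setT phi by exact: measurable_funD.
have -> : (\int[mu]_(x in phi @^-1` B) (normal_pdf 0 s x)%:E =
    \int[mu]_(x in phi @^-1` B) ((EFin \o normal_pdf t s) \o phi) x)%E.
  apply: eq_integral => x _ /=; rewrite !normal_pdfE// /normal_fun /phi.
  by rewrite subr0 addrAC subrr add0r.
rewrite -(@ge0_integral_pushforward _ _ (measurableTypeR R) (measurableTypeR R)
  R phi mphi mu B (EFin \o normal_pdf t s))//.
- by apply: eq_measure_integral => A mA _; exact: lebesgue_measure_translation.
- by apply: measurable_funTS; apply/measurable_EFinP; exact: measurable_normal_pdf.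
- by move=> x _; rewrite lee_fin normal_pdf_ge0.
Qed.

(** The density is determined almost everywhere by the measure, so it can be
    exchanged with the Radon-Nikodym derivative. *)
Lemma integral_normal_prob m s (f : R -> \bar R) :
    (normal_prob m s).-integrable setT f ->
  (\int[normal_prob m s]_x f x = \int[mu]_x (f x * (normal_pdf m s x)%:E))%E.
Proof.
move=> fi; have dom := normal_prob_dominates m s.
rewrite -(Radon_Nikodym_change_of_variables dom)//=.
have mf := measurable_int _ fi.
apply: ae_eq_integral => //.
- by apply: emeasurable_funM => //; apply: (measurable_int mu); exact: Radon_Nikodym_integrable.
- by apply: emeasurable_funM => //; apply/measurable_EFinP; exact: measurable_normal_pdf.
- apply: ae_eqe_mul2l; rewrite Radon_NikodymE//.
  case: cid => /= h [h1 h2 h3].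
  apply: integral_ae_eq => //=; first by apply/measurable_EFinP; exact: measurable_normal_pdf.
  by move=> E _ mE; rewrite -h3.
Qed.

Lemma normal_peak_double s : 0 < s -> normal_peak (2 * s) = normal_peak s / 2.
Proof.
move=> s0; rewrite /normal_peak -invfM; congr (_^-1).
have -> : (2 * s) ^+ 2 * pi *+ 2 = 2 ^+ 2 * (s ^+ 2 * pi *+ 2) by ring.
by rewrite sqrtrM ?sqr_ge0// sqrtr_sqr ger0_norm// mulrC.
Qed.

(** Doubling the standard deviation leaves a Gaussian factor in the ratio of the
    densities, which is small where [x] is large. *)
Lemma normal_pdf_tail s a x : 0 < s -> 0 < a -> a < `|x| ->
  normal_pdf 0 s x <= 6 * s ^+ 2 / a ^+ 2 * normal_pdf 0 (2 * s) x.
Proof.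
move=> s0 a0 ax; have s'0 : 0 < 2 * s by rewrite mulr_gt0.
rewrite !normal_pdfE ?gt_eqF//= normal_peak_double//.
set p := normal_peak s; have p0 : 0 < p by rewrite normal_peak_gt0// gt_eqF.
rewrite /normal_fun !subr0.
have xa : a ^+ 2 < x ^+ 2 by rewrite -(real_normK (num_real x)) ltr_pXn2r ?nnegrE// ltW.
have s20 : 0 < s ^+ 2 by rewrite exprn_gt0.
have a20 : 0 < a ^+ 2 by rewrite exprn_gt0.
pose y := 3 * x ^+ 2 / (8 * s ^+ 2).
have x20 : 0 < x ^+ 2 by exact: lt_trans a20 xa.
have y0 : 0 < y by apply: divr_gt0; exact: mulr_gt0.
have -> : - x ^+ 2 / (s ^+ 2 *+ 2) = - x ^+ 2 / ((2 * s) ^+ 2 *+ 2) - y.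
  by rewrite /y; field; rewrite gt_eqF.
rewrite expRD.
set E := expR _; have E0 : 0 < E by exact: expR_gt0.
have ey : expR (- y) <= y^-1.
  rewrite expRN lef_pV2 ?posrE ?expR_gt0//.
  by apply: le_trans (expR_ge1Dx y); rewrite lerDr.
have yy : y^-1 <= 3 * s ^+ 2 / a ^+ 2.
  have sax : s ^+ 2 * a ^+ 2 <= s ^+ 2 * x ^+ 2 by rewrite ler_pM2l// ltW.
  have x30 : 0 < 3 * x ^+ 2 by exact: mulr_gt0.
  rewrite /y invf_div ler_pdivrMr// mulrAC ler_pdivlMr//.
  by have := mulr_gt0 s20 a20; lra.
rewrite (_ : 6 * s ^+ 2 / a ^+ 2 * (p / 2 * E) =
  p * (E * (3 * s ^+ 2 / a ^+ 2))); last by field; rewrite gt_eqF.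
by rewrite ler_pM2l// ler_pM2l//; exact: le_trans yy.
Qed.

Lemma normal_tail s a : 0 < s -> 0 < a ->
  fine (normal_prob 0 s [set x | a < `|x|]) <= 6 * s ^+ 2 / a ^+ 2.
Proof.
move=> s0 a0; set K := 6 * _ / _; set D := [set x | _].
have K0 : 0 <= K by rewrite /K divr_ge0 ?sqr_ge0// mulr_ge0 ?sqr_ge0.
have mD : measurable D.
  exact: (@measurable_far _ R R a id).
rewrite -lee_fin fineK; last exact: fin_num_measure.
rewrite /normal_prob.
have mpdf t' s' : measurable_fun setT (fun x => (normal_pdf t' s' x)%:E).
  by apply/measurable_EFinP; exact: measurable_normal_pdf.
apply: (@le_trans _ _ (\int[mu]_(x in D) (K%:E * (normal_pdf 0 (2 * s) x)%:E))%E).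
  apply: ge0_le_integral => //.
  - by move=> x _; rewrite lee_fin normal_pdf_ge0.
  - by apply: measurable_funTS; exact: mpdf.
  - by apply: measurable_funTS; apply: measurable_funeM; exact: mpdf.
  - by move=> x /= ax; rewrite -EFinM lee_fin; exact: normal_pdf_tail.
apply: (@le_trans _ _ (\int[mu]_x (K%:E * (normal_pdf 0 (2 * s) x)%:E))%E).
  apply: ge0_subset_integral => //; first by apply: measurable_funeM; exact: mpdf.
  by move=> x _; rewrite -EFinM lee_fin mulr_ge0 ?normal_pdf_ge0.
rewrite ge0_integralZl_EFin//; last 2 first.
- by move=> x _; rewrite lee_fin normal_pdf_ge0.
- exact: mpdf.
by rewrite integral_normal_pdf mule1.
Qed.

(** A shift by at most one standard deviation multiplies the density by the
    exponential of a function that is affine in [x]; the density of twice the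
    standard deviation dominates the product. *)
Lemma normal_pdf_shift s t t' x : 0 < s -> `|t - t'| <= s ->
  `|normal_pdf t s x - normal_pdf t' s x| <=
    2 * expR 4 * (`|t - t'| / s) * normal_pdf t (2 * s) x.
Proof.
move=> s0 tts; have s'0 : 0 < 2 * s by rewrite mulr_gt0.
rewrite !normal_pdfE ?gt_eqF//= normal_peak_double//.
set p := normal_peak s; have p0 : 0 < p by rewrite normal_peak_gt0// gt_eqF.
rewrite -mulrBr normrM gtr0_norm// /normal_fun.
pose w := (x - t) / s; pose k := (t' - t) / s.
have k1 : `|k| <= 1.
  by rewrite /k normrM normfV (gtr0_norm s0) ler_pdivrMr// mul1r distrC.
have sn0 : s != 0 by rewrite gt_eqF.
have -> : - (x - t) ^+ 2 / (s ^+ 2 *+ 2) = - w ^+ 2 / 2 by rewrite /w; field.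
have -> : - (x - t') ^+ 2 / (s ^+ 2 *+ 2) = - w ^+ 2 / 2 + (w * k - k ^+ 2 / 2).
  by rewrite /w /k; field.
have -> : - (x - t) ^+ 2 / ((2 * s) ^+ 2 *+ 2) = - w ^+ 2 / 8.
  by rewrite /w; field.
have -> : `|t - t'| / s = `|k|.
  by rewrite /k normrM normfV (gtr0_norm s0) distrC.
set v := w * k - _.
pose b := `|w| + 2^-1.
have b0 : 0 < b by rewrite ltr_wpDl.
have vb : `|v| <= `|k| * b.
  rewrite /v /b mulrDr; apply: le_trans (ler_normB _ _) _.
  rewrite normrM mulrC lerD2l ger0_norm ?divr_ge0 ?sqr_ge0//.
  rewrite -[k ^+ 2](real_normK (num_real k)) ler_pM2r//.
  by rewrite expr2 ler_piMr.
have vb' : `|v| <= b by apply: le_trans vb _; rewrite ler_piMl// ltW.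
have ev : `|1 - expR v| <= `|k| * expR (2 * b).
  have e1 : `|1 - expR v| <= `|v| * expR `|v|.
    have h1 := expR_ge1Dx v; have h2 := expR_ge1Dx (- v).
    have Ev := expR_gt0 v; have EE : expR (- v) * expR v = 1.
      by rewrite -expRD addNr expR0.
    have [v0|v0] := leP 0 v.
      rewrite (ger0_norm v0) ler0_norm; last by lra.
      by nra.
    rewrite (ltr0_norm v0) gtr0_norm; last by rewrite subr_gt0 expR_lt1.
    have : 1 <= expR (- v) by rewrite leNgt expR_lt1; apply/negP; lra.
    by nra.
  apply: le_trans e1 _; apply: (@le_trans _ _ (`|k| * b * expR b)).
    by apply: ler_pM => //; rewrite ler_expR.
  have -> : 2 * b = b + b by ring.
  rewrite -mulrA (expRD b b); apply: ler_wpM2l => //.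
  apply: ler_wpM2r; first exact: expR_ge0.
  by apply: le_trans (expR_ge1Dx b); rewrite lerDr.
rewrite expRD -{1}[expR (- w ^+ 2 / 2)]mulr1 -mulrBr normrM (gtr0_norm (expR_gt0 _)).
have ew : expR (- w ^+ 2 / 2) * expR (2 * b) <= expR 4 * expR (- w ^+ 2 / 8).
  rewrite -!expRD ler_expR /b -[w ^+ 2](real_normK (num_real w)).
  (* The exponent [4] is at least [1 + 8 / 3], from completing the square. *)
  by have := sqr_ge0 (`|w| - 8 / 3); nra.
rewrite (_ : 2 * expR 4 * `|k| * (p / 2 * expR (- w ^+ 2 / 8)) =
   p * (`|k| * (expR 4 * expR (- w ^+ 2 / 8)))); last by field.
rewrite ler_pM2l//.
apply: (@le_trans _ _ (`|k| * (expR (- w ^+ 2 / 2) * expR (2 * b)))).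
  by rewrite mulrCA ler_pM2l ?expR_gt0.
by rewrite ler_wpM2l.
Qed.

End gaussian.

Section gaussian_rv.
Context {dO : measure_display} {Omega : measurableType dO} {R : realType}.
Variable P : probability Omega R.
Local Notation mu := (@lebesgue_measure R).
Variables (s : R) (Z : Omega -> R).
Hypothesis s0 : 0 < s.
Hypothesis mZ : measurable_fun setT Z.
Hypothesis PZ : forall B, measurable B -> P (Z @^-1` B) = normal_prob 0 s B.

Lemma mean_normal t (h : R -> R) M : measurable_fun setT h ->
    (forall x, `|h x| <= M) ->
  \int[P]_w h (t + Z w) = \int[mu]_x (h x * normal_pdf t s x).
Proof.
move=> mh hM.
pose U : Omega -> measurableTypeR R := fun w => t + Z w.
have mU : measurable_fun setT U by exact: measurable_funD.
pose mUm := isMeasurableFun.Build _ _ _ _ _ mU.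
pose U' : {mfun Omega >-> measurableTypeR R} := HB.pack U mUm.
have bh : bounded_rv (h : measurableTypeR R -> R) by split => //; exists M.
have bhU : bounded_rv (fun w => h (t + Z w)).
  by split; [exact: (measurableT_comp mh mU) | exists M => w].
rewrite /Rintegral; congr fine.
transitivity (\int[distribution P U']_x (h x)%:E)%E.
  rewrite integral_distribution//; last exact: bounded_rv_integrable.
  exact/measurable_EFinP.
transitivity (\int[normal_prob t s]_x (h x)%:E)%E.
  apply: eq_measure_integral => A mA _; rewrite /distribution /= /pushforward /=.
  have mt : measurable_fun setT (fun x : R => t + x) by exact: measurable_funD.
  have mA' : measurable ((fun x : R => t + x) @^-1` A).
    by have := mt measurableT _ mA; rewrite setTI.
  by rewrite -(normal_prob_translation t (lt0r_neq0 s0))// -PZ.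
rewrite integral_normal_prob//.
exact: (bounded_rv_integrable (normal_prob t s) bh).
Qed.

(** Shifts longer than the standard deviation need no argument: the difference is
    at most [2 * M]. *)
Lemma mean_normal_shift t t' (h : R -> R) M : measurable_fun setT h ->
    (forall x, `|h x| <= M) ->
  `|\int[P]_w h (t + Z w) - \int[P]_w h (t' + Z w)| <=
    2 * expR 4 * M * (`|t - t'| / s).
Proof.
move=> mh hM.
have M0 : 0 <= M := le_trans (normr_ge0 _) (hM 0).
have bhU u : bounded_rv (fun w => h (u + Z w)).
  split; last by exists M => w.
  by apply: (measurableT_comp mh); exact: measurable_funD.
have k0 : 0 <= `|t - t'| / s by rewrite divr_ge0// ltW.
have e41 : 1 <= expR 4 :> R by rewrite leNgt expR_lt1; apply/negP; lra.
have [tts|stt] := leP `|t - t'| s; last first.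
  apply: (@le_trans _ _ (M + M)).
    by apply: le_trans (ler_normB _ _) _; rewrite lerD//; exact: norm_mean_le.
  have k1 : 1 <= `|t - t'| / s by rewrite ler_pdivlMr// mul1r ltW.
  have -> : 2 * expR 4 * M * (`|t - t'| / s) =
    (M + M) * (expR 4 * (`|t - t'| / s)) by ring.
  by rewrite ler_peMr ?addr_ge0// mulr_ege1.
rewrite !(mean_normal _ mh hM).
have ip u : mu.-integrable setT (EFin \o (fun x => h x * normal_pdf u s x)).
  have iM := integrableZl measurableT M (integrable_normal_pdf u s).
  apply: (le_integrable measurableT _ _ iM).
  - apply/measurable_EFinP; apply: measurable_funM => //.
    exact: measurable_normal_pdf.
  - move=> x _ /=; rewrite lee_fin !normrM (ger0_norm M0).
    by rewrite (ger0_norm (normal_pdf_ge0 u s x)) ler_wpM2r ?normal_pdf_ge0.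
rewrite -RintegralB//.
set K := 2 * _ * _ * _.
have iK : mu.-integrable setT (EFin \o (fun x => K * normal_pdf t (2 * s) x)).
  rewrite (_ : _ \o _ = fun x => (K%:E * (normal_pdf t (2 * s) x)%:E)%E)//.
  by apply: integrableZl => //; exact: integrable_normal_pdf.
have iB := integrableB measurableT (ip t) (ip t').
apply: le_trans (le_normr_Rintegral _ _) _ => //.
apply: (@le_trans _ _ (\int[mu]_x (K * normal_pdf t (2 * s) x))).
  apply: le_Rintegral => //.
    exact: (integrable_abse iB).
  move=> x _; rewrite -mulrBr normrM.
  have := normal_pdf_shift x s0 tts.
  set A := `|_ - _|; set B := normal_pdf _ _ _ => AB.
  apply: (@le_trans _ _ (M * A)).
    by apply: ler_wpM2r => //; exact: normr_ge0.
  apply: le_trans (ler_wpM2l M0 AB) _.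
  by rewrite le_eqVlt; apply/orP; left; apply/eqP; rewrite /K; ring.
rewrite RintegralZl//; last exact: integrable_normal_pdf.
by rewrite /Rintegral integral_normal_pdf mulr1.
Qed.

End gaussian_rv.

(** * Tails of stable laws *)

Section cos_tail.
Context {dO : measure_display} {Omega : measurableType dO} {R : realType}.
Variable P : probability Omega R.

Lemma bounded_rv_cos (U : Omega -> R) :
  measurable_fun setT U -> bounded_rv (fun w => cos (U w)).
Proof.
move=> mU; split; last by exists 1 => w; exact: cos_max.
by apply: measurableT_comp mU; apply: continuous_measurable_fun; exact: continuous_cos.
Qed.

Lemma bounded_rv_sin (U : Omega -> R) :
  measurable_fun setT U -> bounded_rv (fun w => sin (U w)).
Proof.
move=> mU; split; last by exists 1 => w; exact: sin_max.
by apply: measurableT_comp mU; apply: continuous_measurable_fun; exact: continuous_sin.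
Qed.

Lemma markov_mean (U : Omega -> R) (c : R) : bounded_rv U -> (forall w, 0 <= U w) ->
  0 < c -> fine (P [set w | c <= U w]) <= (\int[P]_w U w) / c.
Proof.
move=> bU U0 c0; have [mU _] := bU.
have mA : measurable [set w | c <= U w].
  by have := mU measurableT _ (measurable_itv `[c, +oo[); rewrite setTI preimage_itvcy.
rewrite ler_pdivlMr// mulrC -(mean_indic P mA) -meanZ; last exact: bounded_rv_indic.
apply: le_mean => //; first by apply: bounded_rvZ; exact: bounded_rv_indic.
move=> w; rewrite indicE; have [|] := boolP (w \in _); last by rewrite mulr0.
by rewrite inE mulr1.
Qed.

Let cos1_lt1 : cos 1 < 1 :> R.
Proof.
rewrite -[ltRHS]cos0 ltr_cos// in_itv /= ?lexx ?pi_ge0// ler01.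
by rewrite (le_trans _ (pi_ge2 _))// ler1n.
Qed.

(** On the dyadic shell [2 ^ k * a <= |y| < 2 ^ k.+1 * a] the frequency
    [(2 ^ k * a)^-1] makes [1 - cos] at least [1 - cos 1]. *)
Lemma dyadic_frequency (a y : R) : 0 < a -> a < `|y| ->
  exists k, 1 - cos 1 <= 1 - cos ((a * 2 ^+ k)^-1 * y).
Proof.
move=> a0 ay; pose v := `|y| / a.
have v1 : 1 < v by rewrite ltr_pdivlMr// mul1r.
have [m mP] : exists m, v < 2 ^+ m.
  have := archi_boundP (ltW (lt_trans ltr01 v1)).
  set m := Num.bound _ => mP; exists m; rewrite (lt_trans mP)//.
  by rewrite -natrX ltr_nat ltn_expl.
have ex : exists m, v < 2 ^+ m by exists m.
case: (ex_minnP ex) => [[|k]]; first by rewrite expr0 => h; have := lt_trans v1 h; rewrite ltxx.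
move=> vk min; exists k; rewrite lerD2l lerN2.
have kv : 2 ^+ k <= v by rewrite leNgt; apply/negP => /min; rewrite ltnn.
have u0 : 0 < (a * 2 ^+ k)^-1 by rewrite invr_gt0 mulr_gt0// exprn_gt0.
rewrite -cos_norm normrM (gtr0_norm u0).
have -> : (a * 2 ^+ k)^-1 * `|y| = v / 2 ^+ k.
  by rewrite /v; field; rewrite expf_neq0 ?gt_eqF.
have p0 : 0 < 2 ^+ k :> R by rewrite exprn_gt0.
have v1' : 1 <= v / 2 ^+ k by rewrite ler_pdivlMr// mul1r.
have v2 : v / 2 ^+ k <= 2 by rewrite ler_pdivrMr// -exprS ltW.
have p2 := pi_ge2 R.
by rewrite leNgt ltr_cos ?in_itv /= -?leNgt//; apply/andP; split; lra.
Qed.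

(** Each dyadic shell is met with probability at most a multiple of
    [1 - expR (- (s * u `^ alpha))] for its frequency [u], hence of
    [s * u `^ alpha]; the frequencies decrease geometrically, so the sum over
    the shells converges. *)
Lemma cos_tail_bound (alpha a : R) : 0 < alpha -> 0 < a ->
  exists2 C, 0 <= C & forall (S : Omega -> R) s, measurable_fun setT S -> 0 <= s ->
    (forall u, 0 < u -> \int[P]_w cos (u * S w) = expR (- (s * u `^ alpha))) ->
    fine (P [set w | a < `|S w|]) <= C * s.
Proof.
move=> al0 a0; pose q : R := 2^-1 `^ alpha.
have q0 : 0 < q by rewrite powR_gt0.
have q1 : q < 1.
  have -> : 1 = 1 `^ alpha :> R by rewrite powR1.
  apply: gt0_ltr_powR; rewrite ?nnegrE//.
  by rewrite invf_lt1// ltr1n.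
pose c0 : R := 1 - cos 1.
have c00 : 0 < c0 by rewrite subr_gt0.
pose b := a^-1 `^ alpha.
have b0 : 0 <= b by exact: powR_ge0.
pose C := b / c0 / (1 - q).
have C0 : 0 <= C by rewrite !divr_ge0// ?subr_ge0 ltW.
exists C => // S s mS s0 ES.
pose u k : R := (a * 2 ^+ k)^-1.
have u0 k : 0 < u k by rewrite invr_gt0 mulr_gt0// exprn_gt0.
have uq k : u k `^ alpha = b * q ^+ k.
  rewrite /u invfM powRM ?invr_ge0 ?exprn_ge0 ?(ltW a0)//; congr (_ * _).
  elim: k => [|k IH]; first by rewrite expr0 invr1 powR1.
  by rewrite !exprS invfM powRM ?invr_ge0 ?exprn_ge0// IH.
pose F k := [set w | c0 <= 1 - cos (u k * S w)].
have mu_ k : measurable_fun setT (fun w => u k * S w) by exact: measurable_funM.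
have bU k : bounded_rv (fun w => 1 - cos (u k * S w)).
  by apply: bounded_rvB; [exact: bounded_rv_cst | exact: bounded_rv_cos].
have mF k : measurable (F k).
  have [mU _] := bU k.
  by have := mU measurableT _ (measurable_itv `[c0, +oo[); rewrite setTI preimage_itvcy.
have PF k : fine (P (F k)) <= s * b / c0 * q ^+ k.
  apply: le_trans (markov_mean (bU k) _ c00) _.
    by move=> w; rewrite subr_ge0 cos_le1.
  rewrite meanB; [|exact: bounded_rv_cst|exact: bounded_rv_cos].
  rewrite mean_cst ES// uq mulrAC ler_pM2r ?invr_gt0//.
  by have := expR_ge1Dx (- (s * (b * q ^+ k))); rewrite mulrA; lra.
have sub : [set w | a < `|S w|] `<=` \bigcup_k F k.
  by move=> w /= aS; have [k hk] := dyadic_frequency a0 aS; exists k.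
have mA : measurable [set w | a < `|S w|] by exact: measurable_far.
have mUF : measurable (\bigcup_k F k) by exact: bigcupT_measurable.
rewrite -lee_fin fineK ?fin_num_measure//.
apply: (@le_trans _ _ (P (\bigcup_k F k))); first by apply: le_measure; rewrite ?inE.
apply: le_trans (generalized_Boole_inequality _ mF mUF) _.
apply: lime_le; first by apply: is_cvg_ereal_nneg_natsum.
apply: nearW => n.
have -> : (\sum_(0 <= k < n) P (F k) = (\sum_(0 <= k < n) fine (P (F k)))%:E)%E.
  rewrite -sumEFin; apply: eq_bigr => k _; rewrite fineK//.
  by rewrite fin_num_measure.
rewrite lee_fin; apply: (@le_trans _ _ (\sum_(0 <= k < n) s * b / c0 * q ^+ k)).
  by apply: ler_sum => k _; exact: PF.
rewrite -mulr_sumr big_mkord.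
have -> : C * s = s * b / c0 * (1 - q)^-1 by rewrite /C; ring.
apply: ler_wpM2l; first by rewrite divr_ge0 ?mulr_ge0// ltW.
have q1' : 0 < 1 - q by rewrite subr_gt0.
rewrite -(ler_pM2r q1') mulVf ?gt_eqF// mulrC.
have := subrX1 q n => E; have := exprn_ge0 n (ltW q0).
have -> : (1 - q) * \sum_(i < n) q ^+ i = 1 - q ^+ n.
  by rewrite -[1 - q]opprB mulNr -E opprB.
lra.
Qed.

End cos_tail.

(** * The discretised Fejer kernel *)

Section fejer.
Context {R : realType}.

Lemma cosD2piz (x : R) (z : int) : cos (x + z%:~R * (2 * pi)) = cos x.
Proof.
have E n (y : R) : cos (y + n%:R * (2 * pi)) = cos y.
  have -> : n%:R * (2 * pi) = (pi *+ 2) *+ n :> R.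
    by rewrite -[RHS]mulr_natl; congr (_ * _); rewrite mulr_natl.
  exact: (periodicn (@cosD2pi R) n y).
case: z => n; first exact: E.
by rewrite NegzE mulrNz mulNr -(E n.+1 (x - _)) subrK.
Qed.

Lemma sinD2piz (x : R) (z : int) : sin (x + z%:~R * (2 * pi)) = sin x.
Proof. by rewrite -!cosBpihalf addrAC cosD2piz. Qed.

Lemma cosM (x y : R) : cos x * cos y = (cos (x + y) + cos (x - y)) / 2.
Proof. by rewrite cosB cosD; field. Qed.

(** The product with [2 * sin (b / 2)] telescopes. *)
Lemma sum_cos_arith (phi b : R) m :
  2 * sin (b / 2) * \sum_(j < m) cos (phi - j%:R * b) =
    sin (phi + b / 2) - sin (phi + b / 2 - m%:R * b).
Proof.
elim: m => [|m IH]; first by rewrite big_ord0 mulr0 mul0r subr0 subrr.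
rewrite big_ord_recr /= mulrDr IH.
have E : 2 * sin (b / 2) * cos (phi - m%:R * b) =
    sin (phi - m%:R * b + b / 2) - sin (phi - m%:R * b - b / 2).
  by rewrite (sinD _ (b / 2)) (sinB _ (b / 2)); ring.
rewrite E.
have -> : phi + b / 2 - m.+1%:R * b = phi - m%:R * b - b / 2.
  by rewrite -natr1; field.
have -> : phi + b / 2 - m%:R * b = phi - m%:R * b + b / 2 by ring.
by rewrite addrA subrK.
Qed.

Variable n : nat.
Hypothesis n0 : (0 < n)%N.

Let N := n.*2.
Let nR0 : 0 < n%:R :> R. Proof. by rewrite ltr0n. Qed.
Let NE : N%:R = 2 * n%:R :> R. Proof. by rewrite /N -mul2n natrM. Qed.

(** The grid is twice as fine as the degree of the kernel requires, so that
    multiplying the kernel by a cosine creates no aliasing. *)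
Definition fgrid (j : nat) : R := j%:R * (pi / n%:R).

Definition fejer (t : R) : R :=
  ((\sum_(a < n) cos (a%:R * t)) ^+ 2 + (\sum_(a < n) sin (a%:R * t)) ^+ 2)
    / (n%:R * N%:R).

Lemma fejer_ge0 t : 0 <= fejer t.
Proof. by rewrite divr_ge0// ?addr_ge0 ?sqr_ge0. Qed.

Lemma fejerE t : fejer t =
  \sum_(a < n) \sum_(b < n) cos ((a%:R - b%:R) * t) / (n%:R * N%:R).
Proof.
rewrite /fejer !expr2 !mulr_suml -big_split /= mulr_suml.
apply: eq_bigr => a _; rewrite !mulr_sumr -big_split /= mulr_suml.
by apply: eq_bigr => b _; rewrite mulrBl cosB.
Qed.

(** Discrete orthogonality: a frequency smaller than the number of grid points
    sums to zero over the grid, unless it vanishes. *)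
Lemma sum_cos_grid (z : int) (t : R) : (`|z| < N)%N ->
  \sum_(j < N) cos (z%:~R * (t - fgrid j)) = if z == 0 then N%:R else 0.
Proof.
move=> zN; have [->|z0] := eqVneq z 0.
  under eq_bigr do rewrite mul0r cos0.
  by rewrite sumr_const card_ord.
pose b : R := z%:~R * (pi / n%:R).
have E : 2 * sin (b / 2) * \sum_(j < N) cos (z%:~R * (t - fgrid j)) = 0.
  under eq_bigr => j _.
    rewrite (_ : z%:~R * (t - fgrid j) = z%:~R * t - j%:R * b); last first.
      by rewrite /b /fgrid; ring.
    over.
  rewrite sum_cos_arith; apply/eqP; rewrite subr_eq0; apply/eqP.
  have -> : N%:R * b = z%:~R * (2 * pi) by rewrite NE /b; field; rewrite gt_eqF.
  by rewrite -[in LHS](subrK (z%:~R * (2 * pi)) (_ + _)) sinD2piz.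
have b2 : sin (b / 2) != 0.
  have b2E : b / 2 = z%:~R * pi / N%:R by rewrite NE /b; field; rewrite gt_eqF.
  have zR : `|z%:~R * pi / N%:R : R| = `|z|%N%:R * pi / N%:R.
    rewrite !normrM normfV (ger0_norm (pi_ge0 R)) -intr_norm.
    by rewrite (ger0_norm (ler0n _ N)) -abszE.
  have s0 : 0 < sin (`|b / 2|).
    rewrite b2E zR; apply: sin_gt0_pi.
    have NR0 : 0 < N%:R :> R by rewrite NE mulr_gt0.
    apply/andP; split.
      by rewrite divr_gt0// mulr_gt0 ?pi_gt0// ltr0n absz_gt0.
    by rewrite ltr_pdivrMr// mulrC ltr_pM2l ?pi_gt0// ltr_nat.
  have [h|h] := leP 0 (b / 2).
    by move: s0; rewrite (ger0_norm h) => /gt_eqF ->.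
  by move: s0; rewrite (ltr0_norm h) sinN oppr_gt0 => /lt_eqF ->.
by move/eqP : E; rewrite !mulf_eq0 (negbTE b2) pnatr_eq0 => /eqP.
Qed.

Let diffz (a b : 'I_n) : a%:R - b%:R = (a%:Z - b%:Z)%:~R :> R.
Proof. by rewrite intrB. Qed.

Let diff_lt (a b : 'I_n) : (`|(a : nat)%:Z - (b : nat)%:Z| < n)%N.
Proof. by have := ltn_ord a; have := ltn_ord b; lia. Qed.

Let Nn : (n < N)%N. Proof. by rewrite /N; lia. Qed.

Lemma fejer_sum t : \sum_(j < N) fejer (t - fgrid j) = 1.
Proof.
under eq_bigr do rewrite fejerE.
rewrite exchange_big /=.
have E (a : 'I_n) : \sum_(j < N) \sum_(b < n)
    cos ((a%:R - b%:R) * (t - fgrid j)) / (n%:R * N%:R) = n%:R^-1 :> R.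
  have Eb (b : 'I_n) : \sum_(j < N) cos ((a%:R - b%:R) * (t - fgrid j)) /
      (n%:R * N%:R) = (b == a)%:R / n%:R :> R.
    rewrite -mulr_suml diffz sum_cos_grid ?(ltn_trans (diff_lt a b))//.
    rewrite subr_eq0 eqz_nat eq_sym val_eqE.
    by case: eqVneq => _ /=; rewrite ?mul0r// mulr1n NE; field; rewrite gt_eqF.
  rewrite exchange_big /=; under eq_bigr do rewrite Eb.
  rewrite -mulr_suml (bigD1 a)//= eqxx big1 ?addr0 ?mul1r// => b.
  by move=> /negbTE ->.
under eq_bigr do rewrite E.
by rewrite sumr_const card_ord -[LHS]mulr_natl mulfV// gt_eqF.
Qed.

(** The first Fourier coefficient of the kernel is [1 - n^-1]: this is the
    concentration at the origin that Korovkin's argument needs. *)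
Lemma fejer_concentration t :
  \sum_(j < N) fejer (t - fgrid j) * (1 - cos (t - fgrid j)) = n%:R^-1.
Proof.
under eq_bigr do rewrite mulrBr mulr1.
rewrite sumrB fejer_sum.
suff -> : \sum_(j < N) fejer (t - fgrid j) * cos (t - fgrid j) =
    (n%:R - 1) / n%:R.
  by rewrite mulrBl mulfV ?gt_eqF// mul1r subKr.
have E (a b : 'I_n) : \sum_(j < N)
    cos ((a%:R - b%:R) * (t - fgrid j)) / (n%:R * N%:R) * cos (t - fgrid j) =
    ((b == a.+1 :> nat)%:R + (a == b.+1 :> nat)%:R) / (2 * n%:R) :> R.
  transitivity (\sum_(j < N) (cos ((a%:Z - b%:Z + 1)%:~R * (t - fgrid j)) +
      cos ((a%:Z - b%:Z - 1)%:~R * (t - fgrid j))) / (2 * (n%:R * N%:R)) : R).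
    apply: eq_bigr => j _; rewrite mulrAC cosM diffz.
    set s := t - _; set z : int := _ - _.
    have -> : (z + 1)%:~R * s = z%:~R * s + s by rewrite intrD mulrDl mul1r.
    have -> : (z - 1)%:~R * s = z%:~R * s - s by rewrite intrB mulrBl mul1r.
    by field; rewrite NE mulf_neq0// gt_eqF.
  have ab := diff_lt a b.
  rewrite -mulr_suml big_split /= !sum_cos_grid; try (by rewrite /N; lia).
  have -> : (a%:Z - b%:Z + 1 == 0) = (b == a.+1 :> nat) by apply/idP/idP; lia.
  have -> : (a%:Z - b%:Z - 1 == 0) = (a == b.+1 :> nat) by apply/idP/idP; lia.
  by do 2 case: (_ == _); rewrite /= ?mulr1n ?mulr0n NE; field; rewrite gt_eqF.
transitivity (\sum_(a < n) \sum_(b < n)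
    ((b == a.+1 :> nat)%:R + (a == b.+1 :> nat)%:R) / (2 * n%:R) : R).
  under eq_bigr do rewrite fejerE mulr_suml.
  rewrite exchange_big; apply: eq_bigr => a _ /=.
  under eq_bigr do rewrite mulr_suml.
  by rewrite exchange_big; apply: eq_bigr => b _ /=; rewrite E.
have C1 : \sum_(a < n) \sum_(b < n) (b == a.+1 :> nat)%:R = n%:R - 1 :> R.
  have -> : \sum_(a < n) \sum_(b < n) (b == a.+1 :> nat)%:R =
      \sum_(a < n) ((a.+1 < n)%N)%:R :> R.
    apply: eq_bigr => a _; have [an|an] := ltnP a.+1 n.
      rewrite (bigD1 (Ordinal an))//= eqxx big1 ?addr0// => b.
      by rewrite -val_eqE /= => /negbTE ->.
    by rewrite big1// => b _; rewrite (ltn_eqF (leq_trans (ltn_ord b) an)).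
  case: n n0 => // m _; rewrite big_ord_recr /= ltnn addr0.
  rewrite (eq_bigr (fun=> 1)) => [|i _]; last by rewrite ltnS ltn_ord.
  by rewrite sumr_const card_ord -natr1 addrK.
under eq_bigr do rewrite -mulr_suml big_split /=.
rewrite -mulr_suml big_split /= C1 exchange_big /= C1.
by field; rewrite gt_eqF.
Qed.

End fejer.

(** * Approximation by the product kernel *)

Section product_kernel.
Context {R : realType} {d : nat}.
Implicit Types y : 'I_d -> R.

Definition kern (n : nat) y (j : {ffun 'I_d -> 'I_(n.*2)}) : R :=
  \prod_i fejer n (y i - fgrid n (j i)).

Lemma kern_ge0 n y j : 0 <= kern (n := n) y j.
Proof. by apply: prodr_ge0 => i _; exact: fejer_ge0. Qed.

Lemma kern_sum n y : (0 < n)%N -> \sum_j kern (n := n) y j = 1.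
Proof.
move=> n0; rewrite /kern -(bigA_distr_bigA (fun i (j : 'I_(n.*2)) =>
  fejer n (y i - fgrid n j))) big1// => i _.
exact: fejer_sum.
Qed.

Lemma kern_concentration n y i : (0 < n)%N ->
  \sum_j kern (n := n) y j * (1 - cos (y i - fgrid n (j i))) = n%:R^-1.
Proof.
move=> n0.
pose G k (j : 'I_(n.*2)) := fejer n (y k - fgrid n j) *
  (if k == i then 1 - cos (y k - fgrid n j) else 1).
rewrite (eq_bigr (fun j : {ffun 'I_d -> 'I_(n.*2)} => \prod_k G k (j k))) => [|j _].
  rewrite -(bigA_distr_bigA G) (bigD1 i)//= [X in _ * X]big1 ?mulr1.
    rewrite /G; under eq_bigr do rewrite eqxx.
    exact: fejer_concentration.
  move=> k /negbTE ki; rewrite /G; under eq_bigr do rewrite ki mulr1.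
  exact: fejer_sum.
rewrite /G big_split /=; congr (_ * _).
by rewrite -big_mkcond big_pred1_eq.
Qed.

Lemma cos_away (t u : R) : 0 < t -> t <= pi / 2 -> t <= `|u| ->
  `|u| <= 3 * (pi / 2) -> cos u <= cos t.
Proof.
move=> t0 tpi tu upi; rewrite -(cos_norm u); move: (`|u|) tu upi => {}u tu upi.
have p0 := pi_gt0 R.
have [upi'|upi'] := leP u pi.
  by rewrite leNgt ltr_cos ?in_itv /= -?leNgt//; apply/andP; split; lra.
apply: (@le_trans _ _ 0); last by apply: cos_ge0_pihalf; apply/andP; split; lra.
rewrite -[u](subrK pi) cosDpi oppr_le0.
by apply: cos_ge0_pihalf; apply/andP; split; lra.
Qed.

(** Korovkin's argument: far from [y] the function [1 - cos] dominates a multiple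
    of the oscillation of [g], and its average against the kernel is small. The
    middle half of the period is away from the points where a grid point and
    [y] are close on the circle only. *)
Lemma kern_approx (g : ('I_d -> R) -> R) M e t y n : (0 < n)%N ->
    0 < t -> t <= pi / 2 -> 0 <= e ->
    (forall i, pi / 2 <= y i <= 3 * (pi / 2)) ->
    (forall z, `|g z| <= M) ->
    (forall z, (forall i, `|y i - z i| < t) -> `|g z - g y| <= e) ->
  `|\sum_(j : {ffun 'I_d -> 'I_(n.*2)}) g (fun i => fgrid n (j i)) * kern (n := n) y j - g y| <=
    e + 2 * M / (1 - cos t) * d%:R / n%:R.
Proof.
move=> n0 t0 tpi e0 hy gM ge; have p0 := pi_gt0 R.
have nR0 : 0 < n%:R :> R by rewrite ltr0n.
have M0 : 0 <= M := le_trans (normr_ge0 _) (gM y).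
have ct : 0 < 1 - cos t.
  rewrite subr_gt0 -[ltRHS]cos0 ltr_cos// in_itv /= ?lexx; apply/andP; split; lra.
pose D := 2 * M / (1 - cos t).
have D0 : 0 <= D by rewrite divr_ge0 ?mulr_ge0// ltW.
have pt (j : {ffun 'I_d -> 'I_(n.*2)}) : `|g (fun i => fgrid n (j i)) - g y| <=
    e + D * \sum_i (1 - cos (y i - fgrid n (j i))).
  have s0 : 0 <= \sum_i (1 - cos (y i - fgrid n (j i))).
    by apply: sumr_ge0 => i _; rewrite subr_ge0 cos_le1.
  have [near|] := pselect (forall i, `|y i - fgrid n (j i)| < t).
    apply: le_trans (ge _ near) _; rewrite lerDl mulr_ge0//.
  move=> /existsNP [i /negP]; rewrite -leNgt => far.
  (* Grid points lie in [[0, 2 * pi]], so [y i] differs from them by at most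
     [3 * pi / 2]. *)
  have gr0 : 0 <= fgrid n (j i) :> R by rewrite /fgrid mulr_ge0// divr_ge0// pi_ge0.
  have gr1 : fgrid n (j i) <= 2 * pi :> R.
    rewrite /fgrid mulrCA mulrC ler_pM2r// ler_pdivrMr//.
    by rewrite -natrM ler_nat mul2n ltnW.
  have c : cos (y i - fgrid n (j i)) <= cos t.
    apply: cos_away => //; rewrite ler_norml; have /andP[? ?] := hy i.
    by apply/andP; split; lra.
  have sc : 1 - cos t <= \sum_i (1 - cos (y i - fgrid n (j i))).
    rewrite (bigD1 i)//=; apply: ler_wpDr; last by rewrite lerD2l lerN2.
    by apply: sumr_ge0 => k _; rewrite subr_ge0 cos_le1.
  apply: le_trans (ler_normB _ _) _; rewrite ler_wpDl//.
  apply: (@le_trans _ _ (D * (1 - cos t))); last by rewrite ler_wpM2l.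
  rewrite /D mulfVK ?gt_eqF//; have := gM y.
  by have := gM (fun i => fgrid n (j i)); lra.
have -> : \sum_(j : {ffun 'I_d -> 'I_(n.*2)}) g (fun i => fgrid n (j i)) * kern (n := n) y j - g y =
    \sum_(j : {ffun 'I_d -> 'I_(n.*2)}) (g (fun i => fgrid n (j i)) - g y) * kern (n := n) y j.
  under [in RHS]eq_bigr do rewrite mulrBl.
  by rewrite sumrB -mulr_sumr kern_sum// mulr1.
apply: le_trans (ler_norm_sum _ _ _) _.
apply: (@le_trans _ _ (\sum_j (e * kern (n := n) y j +
    D * \sum_i (kern (n := n) y j * (1 - cos (y i - fgrid n (j i))))))).
  apply: ler_sum => j _; rewrite normrM [X in _ * X]ger0_norm ?kern_ge0//.
  apply: le_trans (ler_wpM2r (kern_ge0 y j) (pt j)) _.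
  by rewrite mulrDl lerD2l -mulrA mulr_suml ler_wpM2l// ler_sum// => i _; rewrite mulrC.
rewrite big_split /= -mulr_sumr kern_sum// mulr1 lerD2l -mulr_sumr exchange_big /=.
under eq_bigr do rewrite kern_concentration//.
by rewrite sumr_const card_ord -[_ *+ d]mulr_natl mulrA.
Qed.

End product_kernel.

(** * Smoothing by the stable law *)

Section elementary.
Context {R : realType}.

Lemma cos_lipschitz (x y : R) : `|cos x - cos y| <= `|x - y|.
Proof.
wlog xy : x y / x < y => [h|].
  have [/h//|/h|->] := ltgtP x y; last by rewrite !subrr.
  by rewrite distrC [leRHS]distrC.
have dc z : z \in `]x, y[ -> is_derive z 1 cos (- sin z) by move=> _; exact: is_derive_cos.
have [|c _ E] := MVT xy dc.
  by apply: continuous_subspaceT => z; exact: continuous_cos.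
rewrite distrC E normrM normrN [`|x - y|]distrC ler_piMl//.
exact: sin_max.
Qed.

Lemma prod_lipschitz (I : Type) (r : seq I) (f g : I -> R) :
    (forall i, `|f i| <= 1) -> (forall i, `|g i| <= 1) ->
  `|\prod_(i <- r) f i - \prod_(i <- r) g i| <= \sum_(i <- r) `|f i - g i|.
Proof.
move=> f1 g1; elim: r => [|i r IH]; first by rewrite !big_nil subrr normr0.
rewrite !big_cons.
have -> : f i * \prod_(j <- r) f j - g i * \prod_(j <- r) g j =
    (f i - g i) * \prod_(j <- r) f j +
    g i * (\prod_(j <- r) f j - \prod_(j <- r) g j) by ring.
apply: le_trans (ler_normD _ _) _; rewrite !normrM; apply: lerD.
  rewrite ler_piMr// normr_prod; apply: prodr_ile1 => j _.
  by rewrite normr_ge0 f1.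
by rewrite -[leRHS]mul1r; apply: ler_pM.
Qed.

Lemma expRN_le (x : R) q : (0 < q)%N -> 0 < x -> expR (- x) <= (q%:R / x) ^+ q.
Proof.
move=> q0 x0; have qR : 0 < q%:R :> R by rewrite ltr0n.
have -> : expR (- x) = expR (- (x / q%:R)) ^+ q.
  by rewrite -expRM_natl; congr expR; field; rewrite gt_eqF.
have y0 : 0 < x / q%:R by rewrite divr_gt0.
apply: lerXn2r; rewrite ?nnegrE ?expR_ge0//; first by rewrite divr_ge0// ltW.
rewrite expRN -[leRHS]invf_div lef_pV2 ?posrE ?expR_gt0//.
by apply: le_trans (expR_ge1Dx _); rewrite lerDr.
Qed.

(** Summable, and a negative power of [1 + k], so that a product of values of
    [decay] is bounded below by a power of the length of a frequency vector. *)
Definition decay (k : nat) : R := ((1 + k%:R) ^+ 2)^-1.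

Lemma decay_ge0 k : 0 <= decay k. Proof. by rewrite invr_ge0 sqr_ge0. Qed.

Lemma decayS k : decay k.+1 <= decay k.
Proof.
have k0 : 0 <= k%:R :> R by [].
have h : 0 < 1 + k%:R :> R by lra.
have h' : 0 < 1 + k.+1%:R :> R by rewrite -natr1; lra.
rewrite /decay lef_pV2 ?posrE ?exprn_gt0//.
by apply: lerXn2r; rewrite ?nnegrE -?natr1; lra.
Qed.

Lemma sum_decay m : \sum_(0 <= k < m) decay k <= 2.
Proof.
case: m => [|m]; first by rewrite big_geq.
suff : \sum_(0 <= k < m.+1) decay k <= 2 - (m.+1%:R)^-1.
  move/le_trans; apply; rewrite gerDl oppr_le0 invr_ge0; exact: ler0n.
elim: m => [|m IH]; first by rewrite big_nat1 /decay addr0 expr1n invr1; lra.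
rewrite big_nat_recr //=; apply: le_trans (lerD IH (lexx _)) _.
rewrite /decay -[m.+2%:R]natr1; set x : R := m.+1%:R.
have x1 : 1 <= x by rewrite ler1n.
rewrite -subr_ge0.
have -> : 2 - (x + 1)^-1 - (2 - x^-1 + ((1 + x) ^+ 2)^-1) =
    (x * (1 + x) ^+ 2)^-1.
  by field; apply/andP; split; rewrite gt_eqF//; lra.
by rewrite invr_ge0 mulr_ge0 ?sqr_ge0//; lra.
Qed.

Lemma sum_decay_dist n a : \sum_(b < n) decay `|a%:Z - b%:Z|%N <= 4.
Proof.
rewrite -(big_mkord xpredT (fun b => decay `|a%:Z - b%:Z|%N)).
have E : \sum_(0 <= b < a + n) decay `|a%:Z - b%:Z|%N <= 4.
  rewrite (big_cat_nat (n := a)) ?leq_addr//= (_ : 4 = 2 + 2); last by lra.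
  apply: lerD.
    rewrite big_nat_rev /=; apply: le_trans (sum_decay a).
    rewrite big_nat [leRHS]big_nat; apply: ler_sum => k /andP[_ ka].
    rewrite (_ : `|_|%N = k.+1); last by lia.
    exact: decayS.
  rewrite -{1}[a]add0n big_addn addKn; apply: le_trans (sum_decay n).
  apply: ler_sum => k _; rewrite (_ : `|_|%N = k)//; lia.
apply: le_trans E; rewrite [leRHS](big_cat_nat (n := n)) ?leq_addl//=.
by rewrite lerDl sumr_ge0// => b _; exact: decay_ge0.
Qed.

(** A negative power of the frequency beats the product of the decay factors,
    and any such power is available at the price of a negative power of [T]. *)
Lemma exp_decay (d q : nat) (alpha T : R) (m : 'I_d -> int) : (0 < q)%N ->
    0 < alpha -> (2 * d + 1)%:R <= alpha * q%:R -> 0 < T ->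
  (\sum_i `|(m i)%:~R|) *
    expR (- (T * Num.sqrt (\sum_i (pi / 2 * (m i)%:~R) ^+ 2) `^ alpha)) <=
  q%:R ^+ q * d%:R * 4 ^+ d * T ^- q * \prod_i decay `|m i|%N.
Proof.
move=> q0 al0 alq T0.
set L := \sum_i `|_|; set r := Num.sqrt _.
have C0 : 0 <= q%:R ^+ q * d%:R * 4 ^+ d * T ^- q.
  have Tq : 0 <= T ^- q by rewrite invr_ge0 exprn_ge0// ltW.
  by apply: mulr_ge0 => //; rewrite !mulr_ge0// exprn_ge0.
have pr0 : 0 <= \prod_i decay `|m i|%N.
  by apply: prodr_ge0 => i _; exact: decay_ge0.
have [m0|/existsNP [i0 /eqP mi0]] := pselect (forall i, m i = 0).
  rewrite /L big1 ?mul0r; first exact: mulr_ge0.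
  by move=> i _; rewrite m0 normr0.
have mr i : `|(m i)%:~R| <= r.
  rewrite /r -sqrtr_sqr ler_wsqrtr// (bigD1 i)//=.
  rewrite ler_wpDr ?sumr_ge0//; first by move=> j _; exact: sqr_ge0.
  rewrite exprMn ler_peMl ?sqr_ge0// expr_ge1 ?divr_ge0 ?pi_ge0//.
  exact: pihalf_ge1.
have r1 : 1 <= r.
  apply: le_trans (mr i0); rewrite -intr_norm ler1z.
  by move: mi0; lia.
have r0 : 0 < r by lra.
have Lr : L <= d%:R * r.
  apply: (@le_trans _ _ (\sum_(i < d) r)); first by apply: ler_sum => i _.
  by rewrite sumr_const card_ord mulr_natl.
have dec : (4 ^+ d * r ^+ (2 * d))^-1 <= \prod_i decay `|m i|%N.
  rewrite exprM -exprMn -exprVn.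
  rewrite -[leLHS](_ : \prod_(i < d) (4 * r ^+ 2)^-1 = _); last first.
    by rewrite prodr_const card_ord.
  apply: ler_prod => i _; rewrite invr_ge0 mulr_ge0 ?sqr_ge0//=.
  have mn : `|m i|%N%:R = `|(m i)%:~R| :> R by rewrite -intr_norm -abszE.
  have a0 : 0 < 1 + `|(m i)%:~R| :> R by rewrite ltr_pwDl.
  have b0 : 0 < 4 * r ^+ 2 by rewrite mulr_gt0// exprn_gt0.
  have c0 : 0 < (1 + `|(m i)%:~R|) ^+ 2 :> R by exact: exprn_gt0.
  rewrite /decay mn lef_pV2 ?posrE//.
  have -> : 4 * r ^+ 2 = (r + r) ^+ 2 by ring.
  apply: lerXn2r; rewrite ?nnegrE; have := normr_ge0 ((m i)%:~R : R); have := mr i; lra.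
have ra : 0 < r `^ alpha by exact: powR_gt0.
have e1 : expR (- (T * r `^ alpha)) <= q%:R ^+ q * T ^- q * r ^- (2 * d + 1).
  apply: le_trans (expRN_le q0 (mulr_gt0 T0 ra)) _.
  rewrite exprMn invfM exprMn -mulrA !exprVn.
  apply: ler_wpM2l; first by rewrite exprn_ge0.
  apply: ler_wpM2l; first by rewrite invr_ge0 exprn_ge0// ltW.
  rewrite lef_pV2 ?posrE ?exprn_gt0//.
  have -> : (r `^ alpha) ^+ q = r `^ (alpha * q%:R).
    by rewrite powRrM powR_mulrn// powR_ge0.
  by rewrite -powR_mulrn ?(ltW r0)// ler_powR.
apply: (@le_trans _ _ (d%:R * r * (q%:R ^+ q * T ^- q * r ^- (2 * d + 1)))).
  by apply: ler_pM => //; exact: sumr_ge0.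
apply: le_trans (ler_wpM2l C0 dec); rewrite le_eqVlt; apply/orP; left; apply/eqP.
rewrite addn1 exprS; field.
by rewrite !expf_neq0// gt_eqF.
Qed.

End elementary.

Section stable_kernel.
Context {dO : measure_display} {Omega : measurableType dO} {R : realType}.
Variable P : probability Omega R.
Context {d : nat}.
Variables (alpha T : R) (S : Omega -> 'rV[R]_d).
Hypothesis mS : forall i, measurable_fun setT (fun w => S w ord0 i).
Hypothesis ES : forall xi : 'rV[R]_d,
  \int[P]_w cos (dotv xi (S w)) = expR (- (T * eucl_norm xi `^ alpha)).
Hypothesis ES0 : forall xi : 'rV[R]_d, \int[P]_w sin (dotv xi (S w)) = 0.

Let psi (q : R) := expR (- (T * Num.sqrt q `^ alpha)).

Let mdot (xi : 'rV[R]_d) : measurable_fun setT (fun w => dotv xi (S w)).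
Proof. by apply: measurable_sum => i; exact: measurable_funM. Qed.

Let shift (xi : 'rV[R]_d) (m : R) (i : 'I_d) := xi + m *: delta_mx ord0 i.

Let dotv_shiftl xi m i v : dotv (shift xi m i) v = dotv xi v + m * v ord0 i.
Proof.
rewrite /dotv /shift (eq_bigr (fun j => xi ord0 j * v ord0 j +
    (if j == i then m * v ord0 j else 0))).
  by rewrite big_split /= -big_mkcond big_pred1_eq.
move=> j _; rewrite !mxE eqxx /= eq_sym mulrDl; congr (_ + _).
by case: (_ == _); rewrite ?mulr1 ?mulr0 ?mul0r.
Qed.

Let dotv_shift (xi : 'rV[R]_d) m i : xi ord0 i = 0 ->
  dotv (shift xi m i) (shift xi m i) = dotv xi xi + m ^+ 2.
Proof.
move=> xi0; rewrite dotv_shiftl.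
have -> : dotv xi (shift xi m i) = dotv (shift xi m i) xi.
  by apply: eq_bigr => j _; exact: mulrC.
rewrite dotv_shiftl xi0 mulr0 addr0 !mxE xi0 add0r !eqxx mulr1.
by rewrite expr2.
Qed.

Lemma mean_cos_affine phi (xi : 'rV[R]_d) :
  \int[P]_w cos (phi + dotv xi (S w)) = cos phi * psi (dotv xi xi).
Proof.
under eq_Rintegral do rewrite cosD.
rewrite meanB ?meanZ ?ES ?ES0 ?mulr0 ?subr0//.
- exact: bounded_rv_sin.
- exact: bounded_rv_cos.
- by apply: bounded_rvZ; exact: bounded_rv_cos.
- by apply: bounded_rvZ; exact: bounded_rv_sin.
Qed.

(** A product of cosines is an average of cosines of sums, in which each frequency
    occurs with either sign. The characteristic function depends on the
    Euclidean norm of the frequency vector only, so it does not see the signs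
    and factors out. *)
Lemma mean_prod_cos (r : seq 'I_d) (c m : 'I_d -> R) phi (xi : 'rV[R]_d) :
    uniq r -> (forall i, i \in r -> xi ord0 i = 0) ->
  \int[P]_w ((\prod_(i <- r) cos (c i + m i * S w ord0 i)) *
             cos (phi + dotv xi (S w))) =
    (\prod_(i <- r) cos (c i)) * cos phi *
      psi (dotv xi xi + \sum_(i <- r) m i ^+ 2).
Proof.
elim: r phi xi => [|i r IH] phi xi /=.
  move=> _ _; under eq_Rintegral do rewrite big_nil mul1r.
  by rewrite mean_cos_affine !big_nil mul1r addr0.
move=> /andP[ir ur] xi0.
have xi0i : xi ord0 i = 0 by apply: xi0; rewrite mem_head.
have xir k : forall j, j \in r -> (shift xi k i) ord0 j = 0.
  move=> j jr; rewrite !mxE xi0 ?in_cons ?jr ?orbT// add0r eqxx /=.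
  by case: eqVneq => [E|]; rewrite ?mulr0//; rewrite -E jr in ir.
pose U k b w := (\prod_(i <- r) cos (c i + m i * S w ord0 i)) *
  cos (b + dotv (shift xi k i) (S w)).
have bU k b : bounded_rv (U k b).
  apply: bounded_rvM; last by apply: bounded_rv_cos; exact: measurable_funD.
  elim: (r) => [|j r' IHr].
    by under eq_fun do rewrite big_nil; exact: bounded_rv_cst.
  under eq_fun do rewrite big_cons; apply: bounded_rvM => //.
  by apply: bounded_rv_cos; apply: measurable_funD => //; exact: measurable_funM.
transitivity (\int[P]_w (2^-1 * (U (m i) (phi + c i) w + U (- m i) (phi - c i) w))).
  apply: eq_Rintegral => w _; rewrite big_cons /U !dotv_shiftl.
  rewrite mulrAC mulrC [cos (c i + _) * _]mulrC cosM -!mulrDr.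
  rewrite (_ : phi + dotv xi (S w) + (c i + m i * S w ord0 i) =
    phi + c i + (dotv xi (S w) + m i * S w ord0 i)); last by ring.
  rewrite (_ : phi + dotv xi (S w) - (c i + m i * S w ord0 i) =
    phi - c i + (dotv xi (S w) - m i * S w ord0 i)); last by ring.
  by rewrite mulNr; ring.
rewrite meanZ; last exact: bounded_rvD.
rewrite RintegralD//; try exact: bounded_rv_integrable.
rewrite (IH _ (shift xi (m i) i) ur (xir _)) (IH _ (shift xi (- m i) i) ur (xir _)).
rewrite !dotv_shift// sqrrN !big_cons addrA.
by rewrite cosB cosD; field.
Qed.

(** The kernel is a trigonometric polynomial, so its smoothed version is known
    explicitly: each frequency is damped by the characteristic function. *)
Lemma mean_kern n (y : 'I_d -> R) (j : {ffun 'I_d -> 'I_(n.*2)}) :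
  \int[P]_w kern (fun i => y i + pi / 2 * S w ord0 i) j =
  \sum_(p : {ffun 'I_d -> 'I_n * 'I_n})
    (\prod_i cos (((p i).1%:R - (p i).2%:R) * (y i - fgrid n (j i)))) *
    psi (\sum_i (pi / 2 * ((p i).1%:R - (p i).2%:R)) ^+ 2) /
      (n%:R * n.*2%:R) ^+ d.
Proof.
pose dif (p : 'I_n * 'I_n) : R := p.1%:R - p.2%:R.
pose c (p : {ffun 'I_d -> 'I_n * 'I_n}) i := dif (p i) * (y i - fgrid n (j i)).
pose m (p : {ffun 'I_d -> 'I_n * 'I_n}) i := pi / 2 * dif (p i).
have E w : kern (fun i => y i + pi / 2 * S w ord0 i) j =
    \sum_(p : {ffun 'I_d -> 'I_n * 'I_n})
      ((n%:R * n.*2%:R) ^+ d)^-1 *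
      ((\prod_(i <- enum 'I_d) cos (c p i + m p i * S w ord0 i)) *
       cos (0 + dotv 0 (S w))).
  rewrite /kern.
  under eq_bigr do rewrite fejerE pair_bigA /=.
  rewrite (bigA_distr_bigA (fun i (p : 'I_n * 'I_n) =>
    cos (dif p * (y i + pi / 2 * S w ord0 i - fgrid n (j i))) / (n%:R * n.*2%:R))).
  apply: eq_bigr => p _.
  have -> : dotv 0 (S w) = 0 by apply: big1 => i _; rewrite mxE mul0r.
  rewrite addr0 cos0 mulr1 big_enum big_split /= mulrC; congr (_ * _).
    by rewrite prodr_const card_ord exprVn.
  by apply: eq_bigr => i _; congr cos; rewrite /c /m; ring.
have bm (p : {ffun 'I_d -> 'I_n * 'I_n}) : bounded_rv (fun w =>
     (\prod_(i <- enum 'I_d) cos (c p i + m p i * S w ord0 i)) *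
       cos (0 + dotv 0 (S w))).
  apply: bounded_rvM; last by apply: bounded_rv_cos; exact: measurable_funD.
  elim: (enum _) => [|i r IHr].
    by under eq_fun do rewrite big_nil; exact: bounded_rv_cst.
  under eq_fun do rewrite big_cons; apply: bounded_rvM => //.
  by apply: bounded_rv_cos; apply: measurable_funD => //; exact: measurable_funM.
under eq_Rintegral do rewrite E.
rewrite mean_sum; last by move=> p; exact: bounded_rvZ.
apply: eq_bigr => p _; rewrite meanZ// mean_prod_cos ?enum_uniq//; last first.
  by move=> i _; rewrite mxE.
have -> : dotv (0 : 'rV[R]_d) 0 = 0 by apply: big1 => i _; rewrite mxE mul0r.
by rewrite cos0 mulr1 add0r !big_enum mulrC.
Qed.

Lemma bounded_rv_kern n (y : 'I_d -> R) (j : {ffun 'I_d -> 'I_(n.*2)}) :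
  bounded_rv (fun w => kern (fun i => y i + pi / 2 * S w ord0 i) j).
Proof.
rewrite /kern; elim: (index_enum _) => [|i r IHr].
  by under eq_fun do rewrite big_nil; exact: bounded_rv_cst.
under eq_fun do rewrite big_cons; apply: bounded_rvM => //.
under eq_fun do rewrite fejerE.
apply: bounded_rv_sum => a; apply: bounded_rv_sum => b.
under eq_fun do rewrite mulrC; apply: bounded_rvZ; apply: bounded_rv_cos.
apply: measurable_funM => //; apply: measurable_funB => //.
by apply: measurable_funD => //; exact: measurable_funM.
Qed.

(** The frequencies of the kernel are differences of two integers below [n], so
    each lattice point occurs at most [n ^ d] times; together with the number
    of grid points this cancels the normalisation of the kernel. *)
Lemma mean_kern_lipschitz n q (y y' : 'I_d -> R) (D : R) :
    (0 < n)%N -> (0 < q)%N -> 0 < alpha -> (2 * d + 1)%:R <= alpha * q%:R ->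
    0 < T -> 0 <= D -> (forall i, `|y i - y' i| <= D) ->
  \sum_(j : {ffun 'I_d -> 'I_(n.*2)})
    `|\int[P]_w kern (fun i => y i + pi / 2 * S w ord0 i) j -
      \int[P]_w kern (fun i => y' i + pi / 2 * S w ord0 i) j| <=
  D * (q%:R ^+ q * d%:R * 16 ^+ d * T ^- q).
Proof.
move=> n0 q0 al0 alq T0 D0 yD.
have nR : 0 < n%:R :> R by rewrite ltr0n.
have NR : 0 < n.*2%:R :> R by rewrite ltr0n double_gt0.
pose dif (p : 'I_n * 'I_n) : int := p.1%:Z - p.2%:Z.
have difE (p : 'I_n * 'I_n) : p.1%:R - p.2%:R = (dif p)%:~R :> R.
  by rewrite /dif intrB.
pose K := q%:R ^+ q * d%:R * 4 ^+ d * T ^- q.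
have K0 : 0 <= K.
  have Tq : 0 <= T ^- q by rewrite invr_ge0 exprn_ge0// ltW.
  by apply: mulr_ge0 => //; rewrite !mulr_ge0// exprn_ge0.
pose Q := ((n%:R * n.*2%:R) ^+ d)^-1 : R.
have Q0 : 0 <= Q by rewrite invr_ge0 exprn_ge0// mulr_ge0.
have one (j : {ffun 'I_d -> 'I_(n.*2)}) :
    `|\int[P]_w kern (fun i => y i + pi / 2 * S w ord0 i) j -
      \int[P]_w kern (fun i => y' i + pi / 2 * S w ord0 i) j| <=
    \sum_(p : {ffun 'I_d -> 'I_n * 'I_n})
      D * K * Q * \prod_i decay `|dif (p i)|%N.
  rewrite !mean_kern -sumrB; apply: le_trans (ler_norm_sum _ _ _) _.
  apply: ler_sum => p _; rewrite -!mulrBl !normrM (ger0_norm (expR_ge0 _)).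
  rewrite -/Q (ger0_norm Q0) /psi.
  have -> : \sum_i (pi / 2 * ((p i).1%:R - (p i).2%:R)) ^+ 2 =
      \sum_i (pi / 2 * (dif (p i))%:~R) ^+ 2 :> R.
    by apply: eq_bigr => i _; rewrite difE.
  set e := expR _.
  have e0 : 0 <= e by exact: expR_ge0.
  have L : `|\prod_i cos (((p i).1%:R - (p i).2%:R) * (y i - fgrid n (j i))) -
      \prod_i cos (((p i).1%:R - (p i).2%:R) * (y' i - fgrid n (j i)))| <=
      D * \sum_i `|(dif (p i))%:~R|.
    apply: le_trans (prod_lipschitz _ _ _) _; try by move=> i; exact: cos_max.
    rewrite mulr_sumr; apply: ler_sum => i _; apply: le_trans (cos_lipschitz _ _) _.
    rewrite difE -mulrBr normrM mulrC ler_wpM2r//.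
    have -> : y i - fgrid n (j i) - (y' i - fgrid n (j i)) = y i - y' i by ring.
    exact: yD.
  apply: le_trans (ler_wpM2r Q0 (ler_wpM2r e0 L)) _.
  have ED := exp_decay (fun i => dif (p i)) q0 al0 alq T0.
  rewrite -/e -/K in ED.
  have -> : D * (\sum_i `|(dif (p i))%:~R|) * e * Q =
      D * Q * ((\sum_i `|(dif (p i))%:~R|) * e) by ring.
  have -> : D * K * Q * \prod_i decay `|dif (p i)|%N =
      D * Q * (K * \prod_i decay `|dif (p i)|%N) by ring.
  by apply: ler_wpM2l => //; exact: mulr_ge0.
apply: (@le_trans _ _ (\sum_(j : {ffun 'I_d -> 'I_(n.*2)}) D * K * Q * (n%:R * 4) ^+ d)).
  apply: ler_sum => j _; apply: le_trans (one j) _.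
  rewrite -mulr_sumr; apply: ler_wpM2l.
    by apply: mulr_ge0 => //; exact: mulr_ge0.
  rewrite -(bigA_distr_bigA (fun (i : 'I_d) (p : 'I_n * 'I_n) => decay `|dif p|%N)).
  rewrite prodr_const card_ord; apply: lerXn2r.
  - by rewrite nnegrE sumr_ge0// => p _; exact: decay_ge0.
  - by rewrite nnegrE mulr_ge0.
  rewrite -(pair_bigA _ (fun a b : 'I_n => decay `|a%:Z - b%:Z|%N)) /=.
  apply: (@le_trans _ _ (\sum_(a < n) 4)).
    by apply: ler_sum => a _; exact: sum_decay_dist.
  by rewrite sumr_const card_ord mulr_natl.
rewrite sumr_const card_ffun !card_ord -[_ *+ _]mulr_natl natrX.
rewrite le_eqVlt; apply/orP; left; apply/eqP; rewrite /K /Q.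
have -> : 16 = 4 * 4 :> R by ring.
have h1 : n%:R ^+ d != 0 :> R by rewrite expf_neq0// gt_eqF.
have h2 : n.*2%:R ^+ d != 0 :> R by rewrite expf_neq0// gt_eqF.
have h3 : T ^+ q != 0 by rewrite expf_neq0// gt_eqF.
by rewrite !exprMn; field; rewrite h1 h2 h3.
Qed.

End stable_kernel.

(** * The process at a fixed time *)

Section continuity.
Context {R : realType} {T : topologicalType} {I : Type}.

Lemma continuous_sum (r : seq I) (f : I -> T -> R) :
  (forall i, continuous (f i)) -> continuous (fun v => \sum_(i <- r) f i v).
Proof.
move=> cf v; elim: r => [|i r IH].
  by under eq_fun do rewrite big_nil; exact: cst_continuous.
under eq_fun do rewrite big_cons.
by apply: cvgD => //; exact: cf.
Qed.

Lemma continuous_prod (r : seq I) (f : I -> T -> R) :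
  (forall i, continuous (f i)) -> continuous (fun v => \prod_(i <- r) f i v).
Proof.
move=> cf v; elim: r => [|i r IH].
  by under eq_fun do rewrite big_nil; exact: cst_continuous.
under eq_fun do rewrite big_cons.
by apply: cvgM => //; exact: cf.
Qed.

End continuity.

Lemma continuous_fejer (R : realType) n : continuous (@fejer R n).
Proof.
rewrite (_ : fejer n = fun t : R =>
  \sum_(a < n) \sum_(b < n) cos ((a%:R - b%:R) * t) / (n%:R * n.*2%:R)); last first.
  by apply/funext => t; rewrite fejerE.
apply: continuous_sum => a; apply: continuous_sum => b t.
apply: cvgM; last exact: cvg_cst.
apply: continuous_comp; last exact: continuous_cos.
exact: mulrl_continuous.
Qed.

Section processes.
Context {dO : measure_display} {Omega : measurableType dO} {R : realType}.
Variable P : probability Omega R.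
Context {d : nat}.
Variable alpha : R.
Variables (Y : R -> Omega -> 'rV[R]_d) (Z : R -> Omega -> R).
Hypothesis alpha_gt0 : 0 < alpha.
Hypothesis Y_stable : symmetric_stable_process P alpha Y.
Hypothesis Z_brownian : brownian_motion P Z.
Hypothesis YZ_indep :
  independent_processes P (borel 'rV[R]_d) Y (borel R) Z.

Let continuous_coord (i : 'I_d) : continuous (fun v : 'rV[R]_d => v ord0 i).
Proof. exact: coord_continuous. Qed.

Let borel_coord (i : 'I_d) (B : set R) : measurable B ->
  borel 'rV[R]_d ((fun v : 'rV[R]_d => v ord0 i) @^-1` B).
Proof.
by move=> mB; apply: borel_preimage => //; rewrite borel_measurable.
Qed.

Lemma measurable_coord v i : 0 <= v -> measurable_fun setT (fun w => Y v w ord0 i).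
Proof.
move=> v0 _ B mB; rewrite setTI; have [mY _ _ _ _] := Y_stable.
exact: (mY v v0 _ (borel_coord i mB)).
Qed.

Lemma measurable_brownian v : 0 <= v -> measurable_fun setT (Z v).
Proof.
move=> v0 _ B mB; rewrite setTI; have [mZ _ _ _ _] := Z_brownian.
by apply: mZ => //; rewrite borel_measurable.
Qed.

Lemma mean_cos_stable v (xi : 'rV[R]_d) : 0 <= v ->
  \int[P]_w cos (dotv xi (Y v w)) = expR (- (v * eucl_norm xi `^ alpha)).
Proof.
move=> v0; have [_ _ _ _ ch] := Y_stable; have [E _] := ch v xi v0.
by move: E; rewrite unlock /Rintegral => ->.
Qed.

Lemma mean_sin_stable v (xi : 'rV[R]_d) : 0 <= v ->
  \int[P]_w sin (dotv xi (Y v w)) = 0.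
Proof.
move=> v0; have [_ _ _ _ ch] := Y_stable; have [_ E] := ch v xi v0.
by move: E; rewrite unlock /Rintegral => ->.
Qed.

Lemma coord_independent_increments i :
  independent_increments P (borel R) (fun v w => Y v w ord0 i).
Proof.
move=> n r B r0 rnd bB; have [_ _ _ [ii _] _] := Y_stable.
have bB' k : borel 'rV[R]_d ((fun v : 'rV[R]_d => v ord0 i) @^-1` B k).
  by apply: borel_coord; have := bB k; rewrite borel_measurable.
have E k w : B k (Y (r k.+1) w ord0 i - Y (r k) w ord0 i) =
    ((fun v : 'rV[R]_d => v ord0 i) @^-1` B k) (Y (r k.+1) w - Y (r k) w).
  by rewrite /preimage /= !mxE.
have := ii n r _ r0 rnd bB'.
under eq_set do under eq_forall do rewrite -E.
by under eq_bigr do under eq_set do rewrite -E.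
Qed.

Lemma eucl_norm_delta (u : R) (i : 'I_d) : 0 <= u ->
  eucl_norm (u *: delta_mx ord0 i : 'rV[R]_d) = u.
Proof.
move=> u0; rewrite /eucl_norm /dotv (bigD1 i)//= big1 ?addr0.
  by rewrite !mxE !eqxx mulr1 -expr2 sqrtr_sqr ger0_norm.
by move=> j /negbTE ji; rewrite !mxE eqxx ji mulr0 mul0r.
Qed.

Lemma stable_increment_tail (a : R) : 0 < a ->
  exists2 C, 0 <= C & forall i s v, 0 <= s -> s <= v ->
    fine (P [set w | a < `|Y v w ord0 i - Y s w ord0 i|]) <= C * (v - s).
Proof.
move=> a0; have [C C0 H] := cos_tail_bound P alpha_gt0 a0.
exists C => // i s v s0 sv; have [_ Y0 _ [_ st] _] := Y_stable.
have vs0 : 0 <= v - s by rewrite subr_ge0.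
have mB : measurable [set x : R | a < `|x|] by exact: (@measurable_far _ R R a id).
have := st s v _ s0 sv (borel_coord i mB).
under eq_set do rewrite /preimage /= !mxE.
under [in X in _ = X -> _]eq_set do rewrite /preimage /= !mxE Y0 mxE subr0.
move=> ->; apply: H => //; first exact: measurable_coord.
move=> u u0; rewrite -[in RHS](eucl_norm_delta i (ltW u0)) -mean_cos_stable//.
apply: eq_Rintegral => w _; congr cos.
rewrite /dotv (bigD1 i)//= big1 ?addr0; first by rewrite !mxE !eqxx mulr1.
by move=> j /negbTE ji; rewrite !mxE eqxx ji mulr0 mul0r.
Qed.

Lemma brownian_increment_tail (a : R) : 0 < a ->
  forall s v, 0 <= s -> s <= v ->
    fine (P [set w | a < `|Z v w - Z s w|]) <= 12 / a ^+ 2 * (v - s).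
Proof.
move=> a0 s v s0; rewrite le_eqVlt => /predU1P[->|sv].
  rewrite (_ : [set _ | _] = set0); first by rewrite measure0 subrr mulr0.
  by apply/seteqP; split => // w /=; rewrite subrr normr0 ltNge (ltW a0).
have mB : measurable [set x : R | a < `|x|] by exact: (@measurable_far _ R R a id).
have [_ _ _ _ nZ] := Z_brownian.
have := nZ s v _ s0 sv; rewrite borel_measurable => /(_ _ mB) -> .
have vs : 0 < 2 * (v - s) by rewrite mulr_gt0// subr_gt0.
have := @normal_tail R (Num.sqrt (2 * (v - s))) a _ a0.
rewrite sqrtr_gt0 sqr_sqrtr ?(ltW vs)// => /(_ vs) /le_trans; apply.
by rewrite le_eqVlt; apply/orP; left; apply/eqP; field; rewrite gt_eqF.
Qed.

Lemma brownian_law v : 0 < v -> forall B, measurable B ->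
  P (Z v @^-1` B) = normal_prob 0 (Num.sqrt (2 * v)) B.
Proof.
move=> v0 B mB; have [_ Z0 _ _ nZ] := Z_brownian.
have := nZ 0 v B (lexx 0) v0; rewrite subr0 borel_measurable => /(_ mB) <-.
by congr (P _); apply/seteqP; split => w /=; rewrite Z0 subr0.
Qed.

Lemma continuous_kern n (y : 'I_d -> R) (j : {ffun 'I_d -> 'I_(n.*2)}) :
  continuous (fun v : 'rV[R]_d => kern (fun i => y i + pi / 2 * v ord0 i) j).
Proof.
rewrite /kern; apply: continuous_prod => i v.
apply: (@continuous_comp _ _ _ (fun u : 'rV[R]_d => u ord0 i)
  (fun t => fejer n (y i + pi / 2 * t - fgrid n (j i)))).
  exact: continuous_coord.
apply: continuous_comp; last exact: continuous_fejer.
apply: cvgB; last exact: cvg_cst.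
by apply: cvgD; [exact: cvg_cst | exact: mulrl_continuous].
Qed.

(** Averages of the values of a bounded function on the grid depend on the
    starting point of the process through the laws of [Z T] and [Y T] only, so
    the estimate is uniform in the number of grid points and in all functions
    with the same bound. *)
Lemma translation_estimate n q (T s s' M D : R) (y y' : 'I_d -> R)
    (phi : {ffun 'I_d -> 'I_(n.*2)} -> R -> R) :
    (0 < n)%N -> (0 < q)%N -> (2 * d + 1)%:R <= alpha * q%:R -> 0 < T ->
    (forall j, measurable_fun setT (phi j)) -> (forall j z, `|phi j z| <= M) ->
    0 <= D -> (forall i, `|y i - y' i| <= D) ->
  `|\int[P]_w (\sum_j phi j (s + Z T w) *
        kern (fun i => y i + pi / 2 * Y T w ord0 i) j) -
    \int[P]_w (\sum_j phi j (s' + Z T w) *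
        kern (fun i => y' i + pi / 2 * Y T w ord0 i) j)| <=
  2 * expR 4 * M * (`|s - s'| / Num.sqrt (2 * T)) +
  M * (D * (q%:R ^+ q * d%:R * 16 ^+ d * T ^- q)).
Proof.
move=> n0 q0 alq T0 mphi phiM D0 yD; have T0' := ltW T0.
have N0 : (0 < n.*2)%N by rewrite double_gt0.
have M0 : 0 <= M := le_trans (normr_ge0 _) (phiM [ffun=> Ordinal N0] 0).
have mZ := measurable_brownian T0'.
have mY i := measurable_coord i T0'.
have bK u j : bounded_rv (fun w => kern (n := n) (fun i => u i + pi / 2 * Y T w ord0 i) j).
  exact: bounded_rv_kern.
have bphi u j : bounded_rv (fun w => phi j (u + Z T w)).
  split; last by exists M.
  by apply: (measurableT_comp (mphi j)); exact: measurable_funD.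
pose k u j := \int[P]_w kern (n := n) (fun i => u i + pi / 2 * Y T w ord0 i) j.
pose e u j := \int[P]_w phi j (u + Z T w).
have EI u v : \int[P]_w (\sum_j phi j (u + Z T w) *
    kern (fun i => v i + pi / 2 * Y T w ord0 i) j) = \sum_j e u j * k v j.
  rewrite mean_sum; last by move=> j; exact: bounded_rvM.
  apply: eq_bigr => j _; apply: mean_mul_indep => //.
  move=> A B mA mB; rewrite setIC muleC; apply: YZ_indep.
    apply: sub_sigma_algebra; exists T => //=.
    exists ((fun v0 : 'rV[R]_d => kern (fun i => v i + pi / 2 * v0 ord0 i) j) @^-1` B) => //.
    by apply: borel_preimage; [exact: continuous_kern | rewrite borel_measurable].
  apply: sub_sigma_algebra; exists T => //=.
  exists ((fun z => phi j (u + z)) @^-1` A) => //.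
  have m : measurable_fun setT (fun z => phi j (u + z)).
    by apply: (measurableT_comp (mphi j)); exact: measurable_funD.
  by have := m measurableT A mA; rewrite setTI borel_measurable.
have k0 v j : 0 <= k v j.
  by apply: Rintegral_ge0 => w _; exact: kern_ge0.
have k1 v : \sum_j k v j = 1.
  rewrite /k -mean_sum//; under eq_Rintegral do rewrite kern_sum//.
  exact: mean_cst.
have e1 u j : `|e u j| <= M by exact: norm_mean_le.
rewrite !EI.
have -> : \sum_j e s j * k y j - \sum_j e s' j * k y' j =
    \sum_j (e s j - e s' j) * k y j + \sum_j e s' j * (k y j - k y' j).
  by rewrite -big_split -sumrB; apply: eq_bigr => j _ /=; ring.
apply: le_trans (ler_normD _ _) _; apply: lerD.
  apply: le_trans (ler_norm_sum _ _ _) _.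
  rewrite -[leRHS]mulr1 -[X in _ <= _ * X](k1 y) mulr_sumr; apply: ler_sum => j _.
  rewrite normrM (ger0_norm (k0 _ _)); apply: ler_wpM2r => //.
  have sq0 : 0 < Num.sqrt (2 * T) by rewrite sqrtr_gt0 mulr_gt0.
  exact: (mean_normal_shift sq0 mZ (brownian_law T0) s s' (mphi j) (phiM j)).
apply: le_trans (ler_norm_sum _ _ _) _.
have ES (xi : 'rV[R]_d) := mean_cos_stable xi T0'.
have ES0 (xi : 'rV[R]_d) := mean_sin_stable xi T0'.
have KL := mean_kern_lipschitz mY ES ES0 n0 q0 alpha_gt0 alq T0 D0 yD.
apply: le_trans (ler_wpM2l M0 KL); rewrite mulr_sumr; apply: ler_sum => j _.
by rewrite normrM ler_wpM2r.
Qed.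

End processes.

(** * Staying in the box for a short time *)

Section exit.
Context {dO : measure_display} {Omega : measurableType dO} {R : realType}.
Variable P : probability Omega R.
Context {d : nat}.
Variable alpha : R.
Variables (Y : R -> Omega -> 'rV[R]_d) (Z : R -> Omega -> R).
Hypothesis alpha_gt0 : 0 < alpha.
Hypothesis Y_stable : symmetric_stable_process P alpha Y.
Hypothesis Z_brownian : brownian_motion P Z.

(** Outside of this event the process stays within distance one half, in each
    coordinate, of its starting point up to time [T]. *)
Definition leaves_early (T : R) : set Omega :=
  (\bigcup_(i in [set: 'I_d])
     exceeds_dyadic (fun v w => Y v w ord0 i) T (2 * 4^-1)) `|`
  exceeds_dyadic Z T (2 * 4^-1).

Let bigcup_enum (F : 'I_d -> set Omega) :
  \bigcup_(i in [set: 'I_d]) F i = \big[setU/set0]_(i <- enum 'I_d) F i.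
Proof.
rewrite -bigcup_seq; congr bigcup; apply/seteqP; split => i //= _.
by rewrite mem_enum.
Qed.

Let mY i v : 0 <= v -> measurable_fun setT (fun w => Y v w ord0 i).
Proof. by move=> v0; exact: (measurable_coord Y_stable). Qed.

Let mZ v : 0 <= v -> measurable_fun setT (Z v).
Proof. exact: (measurable_brownian Z_brownian). Qed.

Lemma measurable_leaves_early T : 0 <= T -> measurable (leaves_early T).
Proof.
move=> T0; apply: measurableU; last exact: (measurable_exceeds_dyadic mZ).
rewrite bigcup_enum; apply: bigsetU_measurable => i _.
exact: (measurable_exceeds_dyadic (mY i)).
Qed.

Let fine_measureU A B : measurable A -> measurable B ->
  fine (P (A `|` B)) <= fine (P A) + fine (P B).
Proof.
move=> mA mB; have mU := measurableU _ _ mA mB.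
by rewrite -lee_fin EFinD !fineK ?fin_num_measure//; exact: measureU2.
Qed.

Lemma leaves_early_bound : exists2 C, 0 <= C & forall T, 0 <= T ->
  fine (P (leaves_early T)) <= C * T.
Proof.
have a0 : 0 < 4^-1 :> R by [].
have [C1 C10 tY] := stable_increment_tail alpha_gt0 Y_stable a0.
have tZ := brownian_increment_tail Z_brownian a0.
pose C := C1 + 12 / 4^-1 ^+ 2.
have C20 : 0 <= 12 / 4^-1 ^+ 2 :> R by rewrite divr_ge0// sqr_ge0.
have C0 : 0 <= C by rewrite addr_ge0.
have CT T A : 0 <= T -> measurable A ->
    (C * T <= 2^-1 -> fine (P A) <= 2 * C * T) -> fine (P A) <= 2 * C * T.
  move=> T0 mA h; have [/h//|CT] := leP (C * T) 2^-1.
  (* For large [T] the bound exceeds one. *)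
  apply: (@le_trans _ _ 1); last by lra.
  by rewrite -lee_fin fineK ?fin_num_measure// probability_le1.
exists ((d%:R + 1) * (2 * C)); first by rewrite !mulr_ge0// addr_ge0.
move=> T T0.
have PZ : fine (P (exceeds_dyadic Z T (2 * 4^-1))) <= 2 * C * T.
  apply: CT => //; first exact: (measurable_exceeds_dyadic mZ).
  move=> CT; have [_ Z0 _ iZ _] := Z_brownian.
  apply: (maximal_inequality mZ Z0 iZ T0 (ltW a0) C0 CT).
  move=> s v s0 sv _; apply: le_trans (tZ s v s0 sv) _.
  by rewrite ler_wpM2r ?subr_ge0// lerDr.
have PY i : fine (P (exceeds_dyadic (fun v w => Y v w ord0 i) T (2 * 4^-1))) <= 2 * C * T.
  apply: CT => //; first exact: (measurable_exceeds_dyadic (mY i)).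
  move=> CT; have [_ Y0 _ _ _] := Y_stable.
  have Y0i w : Y 0 w ord0 i = 0 by rewrite Y0 mxE.
  apply: (maximal_inequality (mY i) Y0i (coord_independent_increments Y_stable i)
    T0 (ltW a0) C0 CT).
  move=> s v s0 sv _; apply: le_trans (tY i s v s0 sv) _.
  by rewrite ler_wpM2r ?subr_ge0// lerDl.
pose F i := exceeds_dyadic (fun v w => Y v w ord0 i) T (2 * 4^-1).
have mF i : measurable (F i) by exact: (measurable_exceeds_dyadic (mY i)).
have mD : measurable (exceeds_dyadic Z T (2 * 4^-1)).
  exact: (measurable_exceeds_dyadic mZ).
have PU (r : seq 'I_d) : measurable (\big[setU/set0]_(i <- r) F i) /\
    fine (P (\big[setU/set0]_(i <- r) F i)) <= \sum_(i <- r) 2 * C * T.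
  elim: r => [|i r [mr IH]].
    by rewrite !big_nil measure0; split.
  rewrite !big_cons; split; first exact: measurableU.
  by apply: le_trans (lerD (PY i) IH); exact: fine_measureU.
have [mr Pr] := PU (enum 'I_d).
apply: (@le_trans _ _ (\sum_(i <- enum 'I_d) 2 * C * T + 2 * C * T)).
  apply: le_trans (lerD Pr PZ); rewrite /leaves_early bigcup_enum.
  exact: fine_measureU.
rewrite big_const_seq count_predT size_enum_ord iter_addr_0 -[_ *+ d]mulr_natl.
by rewrite le_eqVlt; apply/orP; left; apply/eqP; ring.
Qed.

Let right_continuous_coord (i : 'I_d) (w : Omega) (v : R) : 0 <= v ->
  Y r w ord0 i @[r --> v^'+] --> Y v w ord0 i.
Proof.
move=> v0; have [_ _ rc _ _] := Y_stable.
exact: (cvg_comp (fun r => Y r w) (fun u : 'rV[R]_d => u ord0 i) (rc w v v0)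
  (@coord_continuous _ _ _ _ _ _)).
Qed.

Let near_brownian (w : Omega) (v e : R) : 0 <= v -> 0 < e ->
  \forall r \near v, 0 <= r -> `|Z v w - Z r w| < e.
Proof.
move=> v0 e0; have [_ _ cZ _ _] := Z_brownian.
have /subspace_continuousP /(_ v v0) /cvgrPdist_lt /(_ _ e0) := cZ w.
by rewrite near_withinE.
Qed.

Lemma stays_close (T : R) (w : Omega) : ~ leaves_early T w -> forall v, 0 <= v -> v <= T ->
  (forall i, `|Y v w ord0 i| <= 2^-1) /\ `|Z v w| <= 2^-1.
Proof.
move=> nl v v0 vT; have E : 2 * 4^-1 = 2^-1 :> R by field.
have h X : ~ exceeds_dyadic X T (2 * 4^-1) w -> forall m j, (j <= 2 ^ m)%N ->
    `|X (T * j%:R / 2 ^+ m) w| <= 2^-1.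
  move=> nX m j jm; rewrite -E leNgt; apply/negP => Xj.
  by apply: nX; exists m, j.
split.
  move=> i; apply: (right_continuous_dyadic_bound (g := fun v => Y v w ord0 i) _ _ v0 vT).
    by move=> u u0; exact: right_continuous_coord.
  by apply: (h (fun v w => Y v w ord0 i)) => Yi; apply: nl; left; exists i.
apply: (right_continuous_dyadic_bound (g := fun v => Z v w) _ _ v0 vT).
  move=> u u0; apply/cvgrPdist_lt => e e0; rewrite near_withinE.
  have := near_brownian w u0 e0; apply: filterS => r hr ur.
  by apply: hr; rewrite (le_trans u0)// ltW.
by apply: h => Zi; apply: nl; right.
Qed.

Implicit Types (p : 'rV[R]_d * R) (D : set ('rV[R]_d * R)).

Let exit_time_ge0 (X : R -> Omega -> 'rV[R]_d * R) D w : (0 <= exit_time X D w)%E.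
Proof. by apply: le_ereal_inf_tmp => _ [v [v0 _] <-]; rewrite lee_fin. Qed.

Let exit_time_le (X : R -> Omega -> 'rV[R]_d * R) D w v :
  0 <= v -> ~ D (X v w) -> (exit_time X D w <= v%:E)%E.
Proof. by move=> v0 Dv; apply: ereal_inf_lbound; exists v. Qed.

Lemma stopped_start D p w : stopped_product Y Z D p 0 w = p.
Proof.
rewrite /stopped_product /stopped min_l ?exit_time_ge0//=.
have [_ Y0 _ _ _] := Y_stable; have [_ Z0 _ _ _] := Z_brownian.
by rewrite /product_process Y0 Z0 !addr0; case: (p).
Qed.

Lemma stopped_not_left D p T w : 0 <= T ->
    (forall v, 0 <= v -> v <= T -> D (product_process Y Z p v w)) ->
  stopped_product Y Z D p T w = product_process Y Z p T w.
Proof.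
move=> T0 DT; rewrite /stopped_product /stopped min_l//.
apply: le_ereal_inf_tmp => _ [v [v0 Dv] <-]; rewrite lee_fin leNgt.
by apply/negP => vT; apply: Dv; apply: DT => //; exact: ltW.
Qed.

(** At the time when it leaves the box the process may have jumped away from it
    in the first coordinates, but not in the last one. *)
Lemma stopped_halfspace D p v w : 0 <= v -> D p -> D `<=` halfspace d ->
  halfspace d (stopped_product Y Z D p v w).
Proof.
move=> v0 Dp DH; have [_ Y0 _ _ _] := Y_stable; have [_ Z0 _ _ _] := Z_brownian.
rewrite /stopped_product /stopped; set tau := exit_time _ _ _.
set m := mine _ _.
have m0 : (0 <= m)%E by rewrite le_min lee_fin v0 exit_time_ge0.
have mv : (m <= v%:E)%E by rewrite ge_min lexx.
have mfin : m \is a fin_num by rewrite ge0_fin_numE// (le_lt_trans mv)// ltry.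
have mtau : (m <= tau)%E by rewrite ge_min lexx orbT.
have : (fine m)%:E = m by exact: fineK.
move: (fine m) => u um.
have u0 : 0 <= u by rewrite -lee_fin um.
have before r : 0 <= r -> r < u -> 0 <= p.2 + Z r w.
  move=> r0 ru; have := DH (product_process Y Z p r w); apply.
  apply: contrapT => /(exit_time_le r0); rewrite -/tau; apply/negP; rewrite -ltNge.
  by rewrite (lt_le_trans _ mtau)// -um lte_fin.
rewrite /halfspace /= leNgt; apply/negP => neg.
have u_gt0 : 0 < u.
  rewrite lt_neqAle u0 andbT; apply/eqP => E; move: neg; rewrite -E Z0 addr0 ltNge.
  by have := DH _ Dp; rewrite /halfspace /= => ->.
have e0 : 0 < - (p.2 + Z u w) by rewrite oppr_gt0.
have /nbhs_ballP [e /= e'0 he] := near_brownian w u0 e0.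
pose r := Num.max 0 (u - e / 2).
have r0 : 0 <= r by rewrite le_max lexx.
have ru : r < u by rewrite gt_max u_gt0 /= ltrBlDr ltrDl divr_gt0.
have ber : ball u e r.
  have : u - e / 2 <= r by rewrite le_max lexx orbT.
  by rewrite /ball /= ltr_distl => ?; apply/andP; split; lra.
have := he _ ber r0; have := before r r0 ru.
by rewrite ltr_distl => ? /andP[]; lra.
Qed.

End exit.

(** * Harmonic functions as limits of smoothed grid averages *)

Section harmonic.
Context {dO : measure_display} {Omega : measurableType dO} {R : realType}.
Variable P : probability Omega R.
Context {d : nat}.
Variable alpha : R.
Variables (Y : R -> Omega -> 'rV[R]_d) (Z : R -> Omega -> R).
Hypotheses (alpha_gt0 : 0 < alpha) (alpha_lt2 : alpha < 2).
Hypothesis Y_stable : symmetric_stable_process P alpha Y.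
Hypothesis Z_brownian : brownian_motion P Z.
Variables (x : 'rV[R]_d) (t : R).
Hypothesis t_ge0 : 0 <= t.
Let D4 := box alpha 4 (x, t).
Hypothesis box4_sub : D4 `<=` halfspace d.
Implicit Types (p q : 'rV[R]_d * R).

Let side_gt2 : 2 < 4 `^ (2 / alpha) / 2 :> R.
Proof.
pose e := 2 / alpha - 1.
have e0 : 0 < e by rewrite /e subr_gt0 ltr_pdivlMr// mul1r.
have -> : 2 / alpha = 1 + e by rewrite /e addrC subrK.
rewrite powRD; last by rewrite pnatr_eq0 implybT.
rewrite powRr1//.
have : 1 `^ e < 4 `^ e :> R by apply: gt0_ltr_powR; rewrite ?nnegrE// ltr1n.
by rewrite powR1; lra.
Qed.

Lemma in_box4 q : (forall i, `|x ord0 i - q.1 ord0 i| <= 2) -> `|q.2 - t| < 2 ->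
  D4 q.
Proof.
move=> hx ht; split => [i /=|/=]; last by lra.
exact: le_lt_trans (hx i) side_gt2.
Qed.

Lemma box1_close q : box alpha 1 (x, t) q ->
  (forall i, `|x ord0 i - q.1 ord0 i| < 2^-1) /\ `|q.2 - t| < 2^-1.
Proof. by move=> [/= hx ht]; split => [i|]; [have := hx i|]; rewrite ?powR1; lra. Qed.

Lemma t_ge2 : 2 <= t.
Proof.
rewrite leNgt; apply/negP => t2; have t0 := t_ge0.
have : D4 (x, (t - 2) / 2).
  apply: in_box4 => [i|] /=; first by rewrite subrr normr0.
  by rewrite ltr_norml; apply/andP; split; lra.
by move/box4_sub; rewrite /halfspace /= => ?; lra.
Qed.

Lemma nbhs_box4 q : D4 q -> \forall q' \near q, D4 q'.
Proof.
move=> [hx ht]; rewrite /D4 /box.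
have nx : \forall q' \near q, forall i, `|x ord0 i - (q'.1 : 'rV[R]_d) ord0 i| < 4 `^ (2 / alpha) / 2.
  apply: (@filter_forall _ _ (fun i (q' : 'rV[R]_d * R) =>
    `|x ord0 i - q'.1 ord0 i| < 4 `^ (2 / alpha) / 2) (nbhs q) (nbhs_filter q)) => i.
  have c : `|x ord0 i - (q'.1 : 'rV[R]_d) ord0 i| @[q' --> q] --> `|x ord0 i - q.1 ord0 i|.
    apply: cvg_norm; apply: cvgB; first exact: cst_continuous.
    apply: (@cvg_comp _ _ _ (fun q' : 'rV[R]_d * R => q'.1) (fun u : 'rV[R]_d => u ord0 i)).
      exact: cvg_fst.
    exact: coord_continuous.
  exact: (@cvgr_lt _ _ _ (nbhs_filter q) _ _ c _ (hx i)).
have nt : \forall q' \near q, `|q'.2 - t| < 4 / 2.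
  have c : `|q'.2 - t| @[q' --> q] --> `|q.2 - t|.
    by apply: cvg_norm; apply: cvgB; [exact: cvg_snd | exact: cst_continuous].
  exact: (@cvgr_lt _ _ _ (nbhs_filter q) _ _ c _ ht).
by near=> q'; split => /=; near: q'.
Unshelve. all: by end_near. Qed.

Variable f : 'rV[R]_d * R -> R.
Hypothesis f_harmonic : harmonic_on P Y Z D4 f.
Variable M : R.
Hypothesis fM : forall p, halfspace d p -> `|f p| <= M.

Let f_continuous q : D4 q -> {for q, continuous f}.
Proof.
move=> Dq; have [_ cf _] := f_harmonic.
have /subspace_continuousP /(_ q Dq) := cf.
rewrite /prop_for /continuous_at; apply: cvg_trans; apply: cvg_app.
move=> A; rewrite /within /= => h.
apply: (@filterS _ _ (nbhs_filter q) _ _ _ (@filterI _ _ (nbhs_filter q) _ _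
  (nbhs_box4 Dq) h)) => q' [Dq' hq].
exact: hq.
Qed.

(** The fundamental cube of the grid has side 4 and is centred at [x]; the
    angles [0] and [2 * pi] correspond to its two faces. *)
Definition position (a : 'I_d -> R) : 'rV[R]_d :=
  \row_i (x ord0 i - 2 + a i * (2 / pi)).

Definition angle (u : 'rV[R]_d) (i : 'I_d) : R := pi / 2 * (u ord0 i - x ord0 i + 2).

Let position_angle u : position (angle u) = u.
Proof.
apply/rowP => i; rewrite !mxE /angle.
by have := lt0r_neq0 (pi_gt0 R); move: (pi) => c c0; field.
Qed.

(** The cut-off makes [grid_value j] a bounded Borel function on the whole line:
    [f] is only known to be continuous in the large box, and nothing is known
    about it outside the half-space. *)
Definition grid_value n (j : {ffun 'I_d -> 'I_(n.*2)}) : R -> R :=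
  (fun z => f (position (fun i => fgrid n (j i)), z)) \_ `]t - 2, t + 2[.

Let halfspace_near z u : z \in `]t - 2, t + 2[ -> halfspace d (u, z).
Proof. by rewrite in_itv /= => /andP[? _]; rewrite /halfspace /=; have := t_ge2; lra. Qed.

Lemma grid_value_le n j z : `|grid_value (n := n) j z| <= M.
Proof.
rewrite /grid_value patchE; case: ifPn => [|_].
  by rewrite inE => h; apply: fM; exact: halfspace_near.
have tt : t \in `]t - 2, t + 2[ by rewrite in_itv /=; apply/andP; split; lra.
by rewrite normr0; exact: le_trans (normr_ge0 _) (fM (halfspace_near x tt)).
Qed.

Lemma measurable_grid_value n j : (0 < n)%N -> measurable_fun setT (grid_value (n := n) j).
Proof.
move=> n0; have nR : 0 < n%:R :> R by rewrite ltr0n.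
apply/(measurable_restrictT _ (measurable_itv _)).
apply: open_continuous_measurable_fun; first exact: interval_open.
move=> z /set_mem zt; set u := position _.
have Du : D4 (u, z).
  apply: in_box4 => /= [i|]; last first.
    by move: zt; rewrite /= in_itv /= ltr_norml => /andP[? ?]; apply/andP; split; lra.
  rewrite mxE /fgrid.
  have -> : (j i)%:R * (pi / n%:R) * (2 / pi) = 2 * ((j i)%:R / n%:R) :> R.
    have := lt0r_neq0 (pi_gt0 R); move: (pi) => c c0; field.
    by rewrite c0 gt_eqF.
  have h0 : 0 <= (j i)%:R / n%:R :> R by rewrite divr_ge0.
  have h1 : (j i)%:R / n%:R <= 2 :> R.
    by rewrite ler_pdivrMr// -natrM ler_nat mul2n ltnW.
  by rewrite ler_norml; apply/andP; split; lra.
apply: (@continuous_comp _ _ _ (fun z => (u, z)) f); last exact: f_continuous.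
refine (@cvg_pair _ _ _ (nbhs z) (nbhs u) (nbhs z) (nbhs_filter z)
  (nbhs_filter u) (nbhs_filter z) (fun=> u) id _ _); last exact: cvg_id.
exact: cst_continuous.
Qed.

Section fixed_time.
Variables (T : R) (p : 'rV[R]_d * R).
Hypotheses (T_gt0 : 0 < T) (p_box1 : box alpha 1 (x, t) p).

Let T_ge0 : 0 <= T := ltW T_gt0.
Let N := leaves_early Y Z T.

Definition smoothed n (w : Omega) : R :=
  \sum_(j : {ffun 'I_d -> 'I_(n.*2)}) grid_value j (p.2 + Z T w) *
    kern (fun i => angle p.1 i + pi / 2 * Y T w ord0 i) j.

Let U w := f (stopped_product Y Z D4 p T w).

Let p_box4 : D4 p.
Proof.
by have [h1 h2] := box1_close p_box1; apply: in_box4 => [i|]; [have := h1 i|]; lra.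
Qed.

Let bounded_U : bounded_rv U.
Proof.
have [_ _ /(_ p p_box4) [_ _ /(_ T T_ge0) iU _]] := f_harmonic.
split; first by apply/measurable_EFinP; exact: (measurable_int P iU).
exists M => w; apply: fM.
exact: (stopped_halfspace Y_stable Z_brownian w T_ge0 p_box4 box4_sub).
Qed.

Let mean_U : \int[P]_w U w = f p.
Proof.
have [_ _ /(_ p p_box4) [[sF _ _] _ _ mart]] := f_harmonic.
have FT : natural_filtration (borel ('rV[R]_d * R)%type) (stopped_product Y Z D4 p) 0 setT.
  by have [F0 FC _] := sF 0 (lexx 0); have := FC _ F0; rewrite setD0.
have := mart 0 T setT (lexx 0) T_ge0 FT.
rewrite -[LHS]/(\int[P]_w (U w)%:E)%E /Rintegral => ->.
rewrite -[RHS](mean_cst P) /Rintegral; congr fine; apply: eq_integral => w _ /=.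
by rewrite (stopped_start Y_stable Z_brownian).
Qed.

Let bounded_smoothed n : (0 < n)%N -> bounded_rv (smoothed n).
Proof.
move=> n0; apply: bounded_rv_sum => j; apply: bounded_rvM.
  split; last by exists M => w; exact: grid_value_le.
  apply: (measurableT_comp (measurable_grid_value j n0)).
  by apply: measurable_funD => //; exact: (measurable_brownian Z_brownian).
by apply: bounded_rv_kern => i; exact: (measurable_coord Y_stable).
Qed.

Let smoothed_le n w : (0 < n)%N -> `|smoothed n w| <= M.
Proof.
move=> n0; apply: le_trans (ler_norm_sum _ _ _) _.
rewrite -[leRHS]mulr1 -[X in _ <= _ * X](kern_sum
  (fun i => angle p.1 i + pi / 2 * Y T w ord0 i) n0) mulr_sumr.
apply: ler_sum => j _; rewrite normrM (ger0_norm (kern_ge0 _ _)).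
by apply: ler_wpM2r; [exact: kern_ge0 | exact: grid_value_le].
Qed.

Let smoothed_cvg w : ~ N w -> smoothed n.+1 w @[n --> \oo] --> U w.
Proof.
move=> Nw; have close := stays_close Y_stable Z_brownian Nw.
have [px pt] := box1_close p_box1.
have in4 v : 0 <= v -> v <= T -> D4 (product_process Y Z p v w).
  move=> v0 vT; have [cY cZ] := close v v0 vT; apply: in_box4 => /= [i|].
    rewrite mxE; have := cY i; have := px i; rewrite !ler_norml ltr_norml.
    by move=> /andP[? ?] /andP[? ?]; apply/andP; split; lra.
  move: cZ pt; rewrite ler_norml !ltr_norml.
  by move=> /andP[? ?] /andP[? ?]; apply/andP; split; lra.
rewrite /U (stopped_not_left T_ge0 in4).
set X := product_process Y Z p T w; have DX : D4 X by exact: in4.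
have [cY cZ] := close T T_ge0 (lexx T).
have Xt : X.2 \in `]t - 2, t + 2[.
  rewrite in_itv /=; move: cZ pt; rewrite ler_norml ltr_norml /X /=.
  by move=> /andP[? ?] /andP[? ?]; apply/andP; split; lra.
pose g (a : 'I_d -> R) := f (position a, X.2).
have sE n : smoothed n.+1 w = \sum_(j : {ffun 'I_d -> 'I_(n.+1.*2)})
    g (fun i => fgrid n.+1 (j i)) * kern (angle X.1) j.
  apply: eq_bigr => j _; rewrite /grid_value patchE mem_set//; congr (_ * kern _ _).
  by apply/funext => i; rewrite /angle mxE; ring.
have gX : g (angle X.1) = f X by rewrite /g position_angle; case: (X).
have p0 := pi_gt0 R.
have hy i : pi / 2 <= angle X.1 i <= 3 * (pi / 2).
  have := cY i; have := px i; rewrite /angle mxE ler_norml ltr_norml.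
  move=> /andP[? ?] /andP[? ?].
  by apply/andP; split; nra.
apply/cvgrPdist_le => e e0.
have e20 : 0 < e / 2 by rewrite divr_gt0.
have /cvgrPdist_lt /(_ _ e20) := f_continuous DX.
move=> /nbhs_ballP [r /= r0 hr].
pose s := Num.min (pi / 2) (pi / 2 * r).
have s0 : 0 < s by rewrite lt_min !mulr_gt0.
have spi : s <= pi / 2 by rewrite ge_min lexx.
have ge a : (forall i, `|angle X.1 i - a i| < s) -> `|g a - g (angle X.1)| <= e / 2.
  move=> ha; rewrite gX distrC; apply/ltW/hr; split => /=; last first.
    exact: ballxx.
  split => // i j; rewrite ord1 [in X in ball _ _ X]mxE /ball /=.
  have -> : X.1 ord0 j - (x ord0 j - 2 + a j * (2 / pi)) =
      (angle X.1 j - a j) * (2 / pi).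
    by rewrite /angle; have := lt0r_neq0 p0; move: (pi) => c c0; field.
  rewrite normrM (gtr0_norm (divr_gt0 _ p0))// -ltr_pdivlMr ?divr_gt0//.
  rewrite invf_div mulrC; apply: lt_le_trans (ha j) _.
  by rewrite ge_min lexx orbT.
have gM a : `|g a| <= M by apply: fM; exact: halfspace_near.
pose K := 2 * M / (1 - cos s) * d%:R.
have bound n : `|smoothed n.+1 w - f X| <= e / 2 + K / n.+1%:R.
  by rewrite sE -gX; exact: (kern_approx (ltn0Sn n) s0 spi (ltW e20) hy gM ge).
near=> n; rewrite distrC; apply: le_trans (bound n) _.
rewrite [leRHS](splitr e) lerD2l.
have n0 : 0 < n.+1%:R :> R by rewrite ltr0n.
rewrite ler_pdivrMr// mulrC -ler_pdivrMr//.
near: n; exists (Num.bound `|K / (e / 2)|) => // n /= hn.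
apply: le_trans (ler_norm _) _; apply: ltW; apply: lt_le_trans (archi_boundP (normr_ge0 _)) _.
by rewrite ler_nat; apply: leq_trans hn _.
Unshelve. all: by end_near. Qed.

(** As long as the process has not left early, it is in the middle half of the
    fundamental cube, where the averages converge pointwise to [f]; dominated
    convergence turns this into convergence of the expectations. *)
Lemma smoothed_approximates (e : R) : 0 < e ->
  \forall n \near \oo,
    `|f p - \int[P]_w smoothed n.+1 w| <= 2 * M * fine (P N) + e.
Proof.
move=> e0; have mN : measurable N.
  exact: (measurable_leaves_early Y_stable Z_brownian T_ge0).
have M0 : 0 <= M by apply: le_trans (fM (box4_sub p_box4)).
pose h n w : R := `|U w - smoothed n.+1 w| * \1_(~` N) w.
have UM w : `|U w| <= M.
  apply: fM; exact: (stopped_halfspace Y_stable Z_brownian w T_ge0 p_box4 box4_sub).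
have dM n w : `|U w - smoothed n.+1 w| <= 2 * M.
  apply: le_trans (ler_normB _ _) _.
  by have := UM w; have := smoothed_le w (ltn0Sn n); lra.
have bd n : bounded_rv (fun w => `|U w - smoothed n.+1 w|).
  by apply: bounded_rv_norm; apply: bounded_rvB => //; exact: bounded_smoothed.
have bh n : bounded_rv (h n).
  by apply: bounded_rvM => //; apply: bounded_rv_indic; exact: measurableC.
have hc w : h n w @[n --> \oo] --> 0.
  rewrite /h indicE; have [Nw|Nw] := pselect (N w).
    have -> : (w \in ~` N) = false by apply: memNset => /(_ Nw).
    by under eq_fun do rewrite mulr0; exact: cvg_cst.
  rewrite mem_set//; under eq_fun do rewrite mulr1.
  have c : `|U w - smoothed n.+1 w| @[n --> \oo] --> `|U w - U w|.
    by apply: cvg_norm; apply: cvgB; [exact: cvg_cst | exact: smoothed_cvg].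
  by rewrite subrr normr0 in c.
pose hE n w := (h n w)%:E.
have h0 n w : 0 <= h n w by rewrite mulr_ge0// indicE ler0n.
have hM n w : h n w <= 2 * M.
  by apply: le_trans (dM n w); rewrite /h ler_piMr.
have [_ _ cv] : [/\ P.-integrable setT (fun=> 0%E : \bar R),
    [sequence \int[P]_(w in setT) `|hE n w - 0| ]_n @ \oo --> 0%E &
    [sequence \int[P]_(w in setT) hE n w]_n @ \oo --> (\int[P]_(w in setT) 0)%E]%E.
  apply: (@dominated_convergence _ _ _ P setT measurableT hE (fun=> 0%E)
    (fun=> (2 * M)%:E)).
  - by move=> n; apply/measurable_EFinP; case: (bh n).
  - exact: measurable_cst.
  - by apply: aeW => w _; apply: cvg_EFin; [exact: nearW | exact: hc].
  - exact: (bounded_rv_integrable P (bounded_rv_cst (2 * M))).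
  - by apply: aeW => w n _; rewrite /hE abse_EFin lee_fin ger0_norm.
rewrite integral0 in cv.
have cvR : \int[P]_w h n w @[n --> \oo] --> 0 by exact: (fine_cvg cv).
have /cvgrPdist_le /(_ _ e0) := cvR; apply: filterS => n; rewrite sub0r normrN => hn.
rewrite -mean_U -meanB//; last exact: bounded_smoothed.
apply: le_trans (le_normr_Rintegral _ _) _ => //.
  by apply: bounded_rv_integrable; apply: bounded_rvB => //; exact: bounded_smoothed.
have hm : \int[P]_w h n w <= e by apply: le_trans (ler_norm _) hn.
apply: le_trans (lerD (lexx _) hm); rewrite -(mean_indic P mN) -meanZ; last first.
  exact: bounded_rv_indic.
have bN : bounded_rv (fun w => 2 * M * \1_N w).
  by apply: bounded_rvZ; exact: bounded_rv_indic.
rewrite -RintegralD//; try exact: bounded_rv_integrable.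
apply: le_mean => //; first exact: bounded_rvD.
move=> w; rewrite /h !indicE in_setC; case: (w \in N) => /=.
  by rewrite mulr0 mulr1 addr0.
by rewrite mulr0 mulr1 add0r.
Qed.

End fixed_time.
End harmonic.

(** * The Hölder estimate *)

Section distances.
Context {R : realType} {d : nat}.
Implicit Types p q : 'rV[R]_d * R.

Lemma eucl_dist_ge0 p q : 0 <= eucl_dist p q.
Proof. exact: sqrtr_ge0. Qed.

Lemma coord_le_eucl_dist p q i : `|p.1 ord0 i - q.1 ord0 i| <= eucl_dist p q.
Proof.
have s0 : 0 <= dotv (p.1 - q.1) (p.1 - q.1).
  by apply: sumr_ge0 => j _; rewrite -expr2 sqr_ge0.
rewrite -sqrtr_sqr ler_wsqrtr// /eucl_norm sqr_sqrtr// ler_wpDr ?sqr_ge0//.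
rewrite /dotv (bigD1 i)//= !mxE -expr2 lerDl.
by apply: sumr_ge0 => j _; rewrite -expr2 sqr_ge0.
Qed.

Lemma last_le_eucl_dist p q : `|p.2 - q.2| <= eucl_dist p q.
Proof. by rewrite -sqrtr_sqr ler_wsqrtr// lerDr sqr_ge0. Qed.

Lemma eucl_dist_eq0 p q : eucl_dist p q = 0 -> p = q.
Proof.
case: p q => [u a] [v b] E0.
have h1 i : u ord0 i = v ord0 i.
  apply/eqP; rewrite -subr_eq0 -normr_le0 -E0; exact: (coord_le_eucl_dist (u, a) (v, b)).
have h2 : a = b.
  apply/eqP; rewrite -subr_eq0 -normr_le0 -E0; exact: (last_le_eucl_dist (u, a) (v, b)).
by rewrite h2; congr pair; apply/rowP => i; exact: h1.
Qed.

End distances.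

Lemma le_sup_norm (R : realType) (d : nat) (f : 'rV[R]_d * R -> R) p :
  [bounded f q | q in halfspace d] -> halfspace d p -> `|f p| <= sup_norm f.
Proof.
move=> [K [_ fK]] hp; apply: sup_upper_bound; last by exists p.
split; first by exists `|f p|; exists p.
by exists (K + 1) => _ [q hq <-]; apply: fK => //; rewrite ltrDl.
Qed.

Theorem theorem4 (R : realType) (d : nat) (d_ge1 : (1 <= d)%N)
    (alpha : R) (alpha_gt0 : 0 < alpha) (alpha_lt2 : alpha < 2)
    (dO : measure_display) (Omega : measurableType dO)
    (P : probability Omega R)
    (Y : R -> Omega -> 'rV[R]_d) (Z : R -> Omega -> R)
    (Y_stable : symmetric_stable_process P alpha Y)
    (Z_brownian : brownian_motion P Z)
    (YZ_indep : independent_processes P (borel 'rV[R]_d) Y (borel R) Z)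
    (x : 'rV[R]_d) (t : R) (t_ge0 : 0 <= t)
    (box4_sub : box alpha 4 (x, t) `<=` halfspace d) :
  exists gamma c : R, [/\ 0 < gamma, 0 < c &
    forall f : 'rV[R]_d * R -> R,
      [bounded f p | p in halfspace d] ->
      harmonic_on P Y Z (box alpha 4 (x, t)) f ->
      (forall p q, box alpha 1 (x, t) p -> box alpha 1 (x, t) q ->
        `|f p - f q| <= c * sup_norm f * eucl_dist p q `^ gamma)
      /\ holder_continuous_on (box alpha 1 (x, t)) f].
Proof.
have [C C0 hC] := leaves_early_bound alpha_gt0 Y_stable Z_brownian.
(* [q] is the power of [T] that makes the damped frequencies summable. *)
have [q q0 alq] : exists2 q : nat, (0 < q)%N & (2 * d + 1)%:R <= alpha * q%:R.
  have x0 : 0 <= (2 * d + 1)%:R / alpha :> R by rewrite divr_ge0// ltW.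
  exists (Num.bound ((2 * d + 1)%:R / alpha)).+1 => //.
  rewrite mulrC -ler_pdivrMr//; apply: ltW; apply: lt_le_trans (archi_boundP x0) _.
  by rewrite ler_nat.
pose Kq : R := q%:R ^+ q * d%:R * 16 ^+ d.
have Kq0 : 0 <= Kq by rewrite !mulr_ge0// exprn_ge0.
have e40 : 0 < expR 4 :> R by exact: expR_gt0.
pose c : R := 4 * C + 2 * expR 4 + 2 * Kq + 2.
have c0 : 0 < c by rewrite /c; lra.
pose g : R := (q.+1%:R)^-1.
have g0 : 0 < g by rewrite invr_gt0 ltr0n.
have g1 : g <= 1 by rewrite invf_le1 ?ltr0n// ler1n.
have main (f : 'rV[R]_d * R -> R) : [bounded f p | p in halfspace d] ->
    harmonic_on P Y Z (box alpha 4 (x, t)) f ->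
    forall p p', box alpha 1 (x, t) p -> box alpha 1 (x, t) p' ->
    `|f p - f p'| <= c * sup_norm f * eucl_dist p p' `^ g.
  move=> fb fh p p' bp bp'; set M := sup_norm f; set dl := eucl_dist p p'.
  have fM r : halfspace d r -> `|f r| <= M by exact: le_sup_norm.
  have in4 r : box alpha 1 (x, t) r -> box alpha 4 (x, t) r.
    move=> /box1_close [h1 h2]; apply: (in_box4 alpha_gt0 alpha_lt2) => [i|].
      by have := h1 i; lra.
    by lra.
  have M0 : 0 <= M := le_trans (normr_ge0 _) (fM p (box4_sub _ (in4 p bp))).
  have dl0 : 0 <= dl := eucl_dist_ge0 p p'.
  (* Points at distance larger than one only need the bound on [f]. *)
  have [dl1|dl1] := leP dl 1; last first.
    apply: (@le_trans _ _ (2 * M * 1)).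
      apply: le_trans (ler_normB _ _) _.
      have := fM p (box4_sub _ (in4 p bp)); have := fM p' (box4_sub _ (in4 p' bp')).
      by lra.
    apply: ler_pM; rewrite ?mulr_ge0//.
      by apply: ler_wpM2r => //; rewrite /c; lra.
    by rewrite -[X in X <= _](powRr0 dl) ler_powR ?ltW.
  have [dlz|dl_gt0] := eqVneq dl 0.
    by rewrite (eucl_dist_eq0 dlz) subrr normr0 !mulr_ge0 ?powR_ge0 ?(ltW c0).
  have dlp : 0 < dl by rewrite lt_neqAle eq_sym dl_gt0.
  (* With this time the early exits cost [T] and the translation costs
     [dl * T ^- q = T]. *)
  pose T := dl `^ g.
  have T0 : 0 < T by exact: powR_gt0.
  have TS : T ^+ q.+1 = dl.
    by rewrite -powR_mulrn ?powR_ge0// -powRrM mulVf ?powRr1// pnatr_eq0.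
  have T1 : T <= 1.
    have : dl `^ g <= 1 `^ g by apply: ge0_ler_powR; rewrite ?nnegrE// ltW.
    by rewrite powR1.
  apply/ler_addgt0Pl => e e0.
  have e20 : 0 < e / 2 by rewrite divr_gt0.
  have ap := smoothed_approximates alpha_gt0 alpha_lt2 Y_stable Z_brownian t_ge0
    box4_sub fh fM T0 bp e20.
  have ap' := smoothed_approximates alpha_gt0 alpha_lt2 Y_stable Z_brownian t_ge0
    box4_sub fh fM T0 bp' e20.
  have [n [h h']] : exists n,
      `|f p - \int[P]_w smoothed Y Z x t f T p n.+1 w| <=
        2 * M * fine (P (leaves_early Y Z T)) + e / 2 /\
      `|f p' - \int[P]_w smoothed Y Z x t f T p' n.+1 w| <=
        2 * M * fine (P (leaves_early Y Z T)) + e / 2.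
    have [n _ hn] := filterI ap ap'.
    by exists n; apply: hn => /=.
  have angles i : `|angle x p.1 i - angle x p'.1 i| <= 2 * dl.
    rewrite /angle -mulrBr (_ : _ - _ = p.1 ord0 i - p'.1 ord0 i); last by ring.
    have pi0 : 0 <= pi / 2 :> R by rewrite divr_ge0// pi_ge0.
    rewrite normrM (ger0_norm pi0); apply: ler_pM => //; last exact: coord_le_eucl_dist.
    exact/ltW/pihalf_lt2.
  have mg j : measurable_fun setT (grid_value x t f (n := n.+1) j).
    exact: (measurable_grid_value alpha_gt0 alpha_lt2 fh j (ltn0Sn n)).
  have gM j z : `|grid_value x t f (n := n.+1) j z| <= M.
    exact: (grid_value_le alpha_gt0 alpha_lt2 t_ge0 box4_sub fM).
  have := translation_estimate alpha_gt0 Y_stable Z_brownian YZ_indep p.2 p'.2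
    (ltn0Sn n) q0 alq T0 mg gM (mulr_ge0 (ler0n R 2) dl0) angles.
  set G := Rintegral _ _ _; set G' := Rintegral _ _ _ => GG.
  have {}h : `|f p - G| <= 2 * M * fine (P (leaves_early Y Z T)) + e / 2 := h.
  have {}h' : `|f p' - G'| <= 2 * M * fine (P (leaves_early Y Z T)) + e / 2 := h'.
  have PN := hC T (ltW T0).
  have Tq : 0 < T ^- q by rewrite invr_gt0 exprn_gt0.
  have dTq : dl * T ^- q = T.
    by rewrite -TS exprS -mulrA mulfV ?mulr1// expf_neq0// gt_eqF.
  have sT : `|p.2 - p'.2| / Num.sqrt (2 * T) <= T.
    have sT : T ^+ q <= Num.sqrt (2 * T).
      apply: (@le_trans _ _ T).
        by rewrite -[leRHS]expr1; apply: ler_wiXn2l => //; exact: ltW.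
      rewrite -[leLHS](ger0_norm (ltW T0)) -sqrtr_sqr ler_wsqrtr//.
      by rewrite expr2; nra.
    rewrite -[leRHS]dTq; apply: ler_pM => //.
    - exact: last_le_eucl_dist.
    - by rewrite lef_pV2 ?posrE ?exprn_gt0// sqrtr_gt0 mulr_gt0.
  have GG' : `|G - G'| <= M * ((2 * expR 4 + 2 * Kq) * T).
    apply: le_trans GG _.
    have -> : M * (2 * dl * (q%:R ^+ q * d%:R * 16 ^+ d * T ^- q)) =
        M * (2 * Kq * T) by rewrite -[in RHS]dTq /Kq; ring.
    have : M * (`|p.2 - p'.2| / Num.sqrt (2 * T)) <= M * T by exact: ler_wpM2l.
    by nra.
  have MP : M * fine (P (leaves_early Y Z T)) <= M * (C * T) by exact: ler_wpM2l.
  have MT : 0 <= M * T by rewrite mulr_ge0// ltW.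
  rewrite -/T; have -> : e + c * M * T = M * ((2 * expR 4 + 2 * Kq) * T) +
      (4 * (M * (C * T)) + e) + 2 * (M * T) by rewrite /c; ring.
  move: h h' GG' => /=; rewrite !ler_norml.
  by move=> /andP[? ?] /andP[? ?] /andP[? ?]; apply/andP; split; lra.
exists g, c; split => // f fb fh; split; first exact: main.
exists g, (c * sup_norm f); split => //; last exact: main.
apply: mulr_ge0; first exact: ltW.
exact: le_trans (normr_ge0 _) (le_sup_norm fb (t_ge0 : halfspace d (x, t))).
Qed.
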